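(* Let $(p_n)_{n\geq 0}$ be an increasing sequence of prime numbers such that $p_n\geq 5^{2(n+1)}$ for all $n\geq 0$, and let $G=\bigoplus_{n=0}^\infty \mathbb{Z}/p_n\mathbb{Z}$. Then there exists a measure-preserving action $T=(T_g)_{g\in G}$ of $G$ on a standard probability Borel space $(X,\mathcal{B},\mu)$ whose Koopman representation has simple spectrum and which does not have the AT property.
   Context: A measure-preserving action of a countable discrete Abelian group $G$ on a standard probability Borel space $(X,\mathcal{B},\mu)$ is a homomorphism $g\mapsto T_g$ into the group of measure-preserving automorphisms of $(X,\mathcal{B},\mu)$. Its Koopman representation is the unitary representation $g\mapsto U_{T_g}$ on $L^2(X,\mathcal{B},\mu)$, $U_{T_g}f=f\circ T_g$; it has simple spectrum if there is $f\in L^2(X,\mathcal{B},\mu)$ with $L^2(X,\mathcal{B},\mu)=\overline{\mathrm{span}}\{f\circ T_g: g\in G\}$. The action $T$ has the AT (approximate transitivity) property if for every $l\geq 2$, every family of nonnegative functions $f_1,\ldots,f_l\in L^1_+(X,\mathcal{B},\mu)$ and every $\varepsilon>0$ there exist a positive integer $s$, elements $g_1,\ldots,g_s\in G$, real numbers $\lambda_{j,k}>0$ ($1\le j\le l$, $1\le k\le s$) and $f\in L^1_+(X,\mathcal{B},\mu)$ such that $\|f_j-\sum_{k=1}^s\lambda_{j,k}\, f\circ T_{g_k}\|_1<\varepsilon$ for all $1\leq j\leq l$. *)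

(* Defs.v *)
From HB Require Import structures.
From mathcomp Require Import all_boot all_order all_algebra.
From mathcomp Require Import all_classical all_reals all_analysis.
Set Implicit Arguments. Unset Strict Implicit. Unset Printing Implicit Defensive.
Import Order.TTheory GRing.Theory Num.Theory.
Local Open Scope classical_set_scope.
Local Open Scope ring_scope.

Definition Gel (p : nat -> nat) (g : nat -> nat) : Prop :=
  (forall n, (g n < p n)%N) /\ exists N : nat, forall n, (N <= n)%N -> g n = 0%N.
Definition Gzero : nat -> nat := fun _ => 0%N.
Definition Gadd (p : nat -> nat) (g h : nat -> nat) : nat -> nat :=
  fun n => ((g n + h n) %% p n)%N.

Definition standard_borel (R : realType) (d : measure_display)
    (X : measurableType d) : Prop :=
  exists phi : X -> R,
    injective phi /\ measurable_fun [set: X] phi /\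
    measurable (range phi) /\
    (forall A : set X, measurable A -> measurable (phi @` A)).

Definition mp_automorphism (R : realType) (d : measure_display)
    (X : measurableType d) (mu : probability X R) (S : X -> X) : Prop :=
  measurable_fun [set: X] S /\
  (exists S' : X -> X, cancel S S' /\ cancel S' S /\ measurable_fun [set: X] S') /\
  (forall A : set X, measurable A -> mu (S @^-1` A) = mu A).

Definition mp_action (R : realType) (p : nat -> nat) (d : measure_display)
    (X : measurableType d) (mu : probability X R) (T : (nat -> nat) -> X -> X)
    : Prop :=
  (forall g, Gel p g -> mp_automorphism mu (T g)) /\
  T Gzero = id /\
  (forall g h, Gel p g -> Gel p h -> T (Gadd p g h) = T g \o T h).

Definition L2fun (R : realType) (d : measure_display) (X : measurableType d)
    (mu : probability X R) (f : X -> R) : Prop :=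
  measurable_fun [set: X] f /\ (\int[mu]_x ((f x) ^+ 2)%:E < +oo)%E.

(* ---- simple spectrum of the Koopman representation on complex L^2 ------
   A complex function is represented by its real and imaginary parts.
   f = u + i v is a cyclic vector: the finite combinations
   sum_k (a_k + i b_k) (f o T_{g_k}) are dense in L^2(X, mu; C). *)
Definition simple_spectrum (R : realType) (p : nat -> nat) (d : measure_display)
    (X : measurableType d) (mu : probability X R) (T : (nat -> nat) -> X -> X)
    : Prop :=
  exists u v : X -> R, L2fun mu u /\ L2fun mu v /\
  forall a b : X -> R, L2fun mu a -> L2fun mu b ->
  forall eps : R, 0 < eps ->
  exists (s : nat) (g : nat -> nat -> nat) (al be : nat -> R),
    (forall k, (k < s)%N -> Gel p (g k)) /\
    (\int[mu]_x (
        ((a x - \sum_(k < s) (al k * u (T (g k) x) - be k * v (T (g k) x))) ^+ 2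
       + (b x - \sum_(k < s) (al k * v (T (g k) x) + be k * u (T (g k) x))) ^+ 2)%:E)
      < eps%:E)%E.

Definition L1pos (R : realType) (d : measure_display) (X : measurableType d)
    (mu : probability X R) (f : X -> R) : Prop :=
  (forall x, 0 <= f x) /\ mu.-integrable [set: X] (EFin \o f).

Definition AT (R : realType) (p : nat -> nat) (d : measure_display)
    (X : measurableType d) (mu : probability X R) (T : (nat -> nat) -> X -> X)
    : Prop :=
  forall (l : nat), (2 <= l)%N ->
  forall F : nat -> X -> R, (forall j, (j < l)%N -> L1pos mu (F j)) ->
  forall eps : R, 0 < eps ->
  exists (s : nat) (g : nat -> nat -> nat) (lam : nat -> nat -> R) (f : X -> R),
    (0 < s)%N /\
    (forall k, (k < s)%N -> Gel p (g k)) /\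
    (forall j k, (j < l)%N -> (k < s)%N -> 0 < lam j k) /\
    L1pos mu f /\
    forall j, (j < l)%N ->
      (\int[mu]_x (`| F j x - \sum_(k < s) lam j k * f (T (g k) x) |)%:E
        < eps%:E)%E.

(* Main.v *)
Require Import Defs.
From HB Require Import structures.
From mathcomp Require Import all_boot all_order all_algebra all_field.
From mathcomp Require Import all_classical all_reals all_analysis.
From mathcomp Require Import measurable_realfun.
From mathcomp Require Import ring lra zify.
Set Implicit Arguments. Unset Strict Implicit. Unset Printing Implicit Defensive.
Import Order.TTheory GRing.Theory Num.Theory.
Import numFieldNormedType.Exports.
Local Open Scope classical_set_scope.
Local Open Scope ring_scope.

(** Let [G] act on the product of the groups [Z/p_n] by translation, and extend
    this action by the sign cocycle [Phi(x + g) / Phi(x)], where [Phi] is the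
    formal product over [n] of the Legendre symbols of the coordinates (with
    value [1] at [0]). The extension is realized on [0, 1[ by permuting the
    cells of a mixed radix expansion.

    Simple spectrum: no Fourier coefficient of a Legendre symbol modified in
    this way vanishes, so the translates of the sign coordinate span the odd
    functions; a product of small perturbations of [1] generates the even ones,
    and averaging over a far coordinate separates the two parts.

    No approximate transitivity: restricted to finitely many coordinates, the
    indicators of the two values of the sign would be close to [P * f] and
    [Q * f] with [P], [Q], [f] nonnegative. Then [f] lives where the correlation of the sign with [P - Q]
    is nearly maximal. Gauss sums give this correlation second moment at most
    [16/9] times that of white noise; it is odd, so [f] lives on a set whose
    translates by [P + Q] cover at most a fraction slightly above [8/9] of the
    space, although [(P + Q) * f] is nearly [1]. *)

(** * Quadratic characters and convolution on finite abelian groups *)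

(** Joins the finite and the additive structure of a product, so that [dig] below can be built by
    iterating products. *)
HB.instance Definition _ (A B : finZmodType) := GRing.Zmodule.on (A * B)%type.

Fixpoint dig (p : nat -> nat) (n : nat) : finZmodType :=
  if n is m.+1 then (dig p m * 'F_(p m))%type else 'I_1.

Section QuadraticCharacter.
Variables (R : realFieldType) (F : finFieldType).
Hypothesis oddF : odd #|F|.

(** Legendre symbol by Euler's criterion: in odd order [#|F|./2] is half the order of the
    multiplicative group. *)
Definition qchar (x : F) : R :=
  if x == 0 then 0 else if x ^+ #|F|./2 == 1 then 1 else -1.

Lemma qchar0 : qchar 0 = 0. Proof. by rewrite /qchar eqxx. Qed.

Lemma qchar1 : qchar 1 = 1.
Proof. by rewrite /qchar oner_eq0 expr1n eqxx. Qed.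

Lemma qchar_sqr x : x != 0 -> qchar x ^+ 2 = 1.
Proof. by rewrite /qchar => /negPf->; case: ifP => _; rewrite ?sqrrN expr1n. Qed.

Lemma half_power_sign (x : F) :
  x != 0 -> x ^+ #|F|./2 = 1 \/ x ^+ #|F|./2 = -1.
Proof.
move=> x0; have : (x ^+ #|F|./2) ^+ 2 == 1.
  have := expf_card x; rewrite -{1}(odd_double_half #|F|) oddF add1n exprS.
  move=> /(canRL (mulKf x0)); rewrite mulVf //.
  by rewrite -exprM muln2 => ->.
by rewrite sqrf_eq1 => /orP[/eqP->|/eqP->]; [left|right].
Qed.

Lemma qcharM x y : qchar (x * y) = qchar x * qchar y.
Proof.
rewrite /qchar mulf_eq0; have [->|x0] := eqVneq x 0; first by rewrite /= mul0r.
have [->|y0] := eqVneq y 0; first by rewrite /= mulr0.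
rewrite /= exprMn.
case: (half_power_sign x0) => ->; case: (half_power_sign y0) => ->;
  rewrite ?mulrNN ?mul1r ?mulr1 ?eqxx ?mul1r ?mulr1 //.
by case: ifP => _; rewrite ?mulrNN !mulr1.
Qed.

(** Otherwise all [#|F| - 1] nonzero elements would be roots of a polynomial of degree half that
    number. *)
Lemma nonresidue_exists : exists2 a : F, a != 0 & qchar a = -1.
Proof.
have [a /andP[a0 ak]|nores] := pickP [pred a : F | (a != 0) && (a ^+ #|F|./2 != 1)].
  by exists a => //; rewrite /qchar (negPf a0) (negPf ak).
pose P : {poly F} := 'X^(#|F|./2) - 1.
have F1 : (1 < #|F|)%N := finNzRing_gt1 F.
have k0 : (0 < #|F|./2)%N by rewrite half_gt0.
have sP : size P = (#|F|./2).+1 by rewrite size_XnsubC.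
have P0 : P != 0 by rewrite -size_poly_eq0 sP.
have := max_poly_roots P0 (rs := enum [pred a : F | a != 0]).
rewrite enum_uniq sP -cardE.
have -> : #|[pred a : F | a != 0]| = #|F|.-1.
  by rewrite -(cardC1 (0 : F)); apply: eq_card => x; rewrite !inE.
have -> : all (root P) (enum [pred a : F | a != 0]).
  apply/allP => a; rewrite mem_enum inE => a0.
  have := nores a; rewrite /= a0 /= => /negbFE/eqP ak.
  by rewrite rootE !hornerE ak subrr.
move=> /(_ isT isT); rewrite -{1}(odd_double_half #|F|) oddF add1n /= ltnS.
by move: k0; case: (#|F|./2) => // k _; rewrite doubleS -addnn; lia.
Qed.

(** Multiplication by a nonresidue permutes the field and changes the sign of the sum. *)
Lemma sum_qchar : \sum_x qchar x = 0.
Proof.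
have [a a0 qa] := nonresidue_exists.
suff : \sum_x qchar x = - \sum_x qchar x by lra.
rewrite [LHS](reindex_inj (mulfI a0)) /= -sumrN; apply: eq_bigr => x _.
by rewrite qcharM qa mulN1r.
Qed.

Lemma sum_qchar_shift (c : F) :
  \sum_x qchar x * qchar (x + c) = #|F|%:R * (c == 0)%:R - 1.
Proof.
have [->|c0] := eqVneq c 0.
  transitivity (\sum_(x : F) (1 - (x == 0)%:R) : R).
    apply: eq_bigr => x _; rewrite addr0.
    have [->|x0] := eqVneq x 0; first by rewrite qchar0 mul0r subrr.
    by rewrite -expr2 qchar_sqr // subr0.
  rewrite sumrB sumr_const mulr1 (bigD1 0) //= eqxx big1 ?addr0 //.
  by move=> x /negPf->.
rewrite mulr0 sub0r.
(* For [x != 0] the product [qchar x * qchar (x + c)] equals [qchar (1 + c / x)]. With the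
   convention [0^-1 = 0] this argument runs over the whole field, and the extra value [qchar 1] at
   [x = 0] accounts for the [-1]. *)
have inj : injective (fun x : F => 1 + c * x^-1).
  by move=> x y /addrI /(mulfI c0) /invr_inj.
have := sum_qchar; rewrite (reindex_inj inj) /= (bigD1 0) //= invr0 mulr0 addr0 qchar1.
move=> /eqP; rewrite addrC addr_eq0 => /eqP <-.
rewrite (bigD1 0) //= qchar0 mul0r add0r; apply: eq_bigr => x x0.
have -> : x + c = x * (1 + c * x^-1) by rewrite mulrDr mulr1 mulrC -mulrA mulVf ?mulr1.
by rewrite qcharM mulrA -expr2 qchar_sqr // mul1r.
Qed.

Definition qsign (x : F) : R := qchar x + (x == 0)%:R.

Lemma qsign_sqr x : qsign x ^+ 2 = 1.
Proof.
rewrite /qsign; have [->|x0] := eqVneq x 0; first by rewrite qchar0 add0r expr1n.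
by rewrite addr0 qchar_sqr.
Qed.

Lemma sum_qsign : \sum_x qsign x = 1.
Proof.
rewrite big_split /= sum_qchar add0r (bigD1 0) //= eqxx big1 ?addr0 //.
by move=> x /negPf->.
Qed.

End QuadraticCharacter.

(** * Spanning translates, l2 bounds for convolution, and tensor products *)

Section Convolution.
Variable R : realFieldType.

(** Invertibility under correlation: the form, free of complex characters, of the condition that no
    Fourier coefficient of [Phi] vanishes. *)
Definition spanning (H : finZmodType) (Phi : H -> R) :=
  exists q : H -> R, forall x, \sum_h q h * Phi (x + h) = (x == 0)%:R.

(** [C] bounds the squared l2 operator norm of convolution by [Phi], which is the largest squared
    modulus of a Fourier coefficient. *)
Definition conv_bounded (H : finZmodType) (Phi : H -> R) (C : R) :=
  forall q : H -> R,
    \sum_x (\sum_h q h * Phi (x - h)) ^+ 2 <= C * \sum_h q h ^+ 2.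

Lemma sum_delta (H : finType) (f : H -> R) (a : H) :
  \sum_h f h * (h == a)%:R = f a.
Proof.
rewrite (bigD1 a) //= eqxx mulr1 big1 ?addr0 // => h /negPf->.
by rewrite mulr0.
Qed.

(** Superpose translates of the coefficients that produce the delta at [0], weighted by the values
    of [psi]. *)
Lemma spanning_all (H : finZmodType) (Phi psi : H -> R) : spanning Phi ->
  exists q : H -> R, forall x, \sum_h q h * Phi (x + h) = psi x.
Proof.
move=> [q qP]; exists (fun h => \sum_y psi y * q (h + y)) => x.
transitivity (\sum_y psi y * \sum_h q (h + y) * Phi (x + h)).
  under eq_bigr do rewrite mulr_suml.
  rewrite exchange_big /=; apply: eq_bigr => y _; rewrite mulr_sumr.
  by apply: eq_bigr => h _; rewrite mulrA.
rewrite -(sum_delta psi x); apply: eq_bigr => y _; congr (_ * _).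
rewrite (reindex_inj (@addIr _ (- y))) /= -subr_eq0 -opprB oppr_eq0 -qP.
by apply: eq_bigr => h _; rewrite addrNK addrCA addrC.
Qed.

Variables (A B : finZmodType).
Implicit Types (Phi : A -> R) (phi : B -> R).

Definition tensor Phi phi (z : A * B) := Phi z.1 * phi z.2.

Lemma spanning_tensor Phi phi :
  spanning Phi -> spanning phi -> spanning (tensor Phi phi).
Proof.
move=> [q qP] [r rP]; exists (fun z => q z.1 * r z.2) => -[x y].
transitivity (\sum_h \sum_d (q h * Phi (x + h)) * (r d * phi (y + d))).
  by rewrite pair_bigA /=; apply: eq_bigr => -[h d] _; rewrite /tensor /= mulrACA.
under eq_bigr do rewrite -mulr_sumr rP.
rewrite -mulr_suml qP -natrM mulnb.
by congr (_%:R).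
Qed.

(** Convolve in one variable at a time: [r] is the result for the second variable, and each stage
    contributes its own constant. *)
Lemma conv_bounded_tensor Phi phi C D : 0 <= C ->
  conv_bounded Phi C -> conv_bounded phi D ->
  conv_bounded (tensor Phi phi) (C * D).
Proof.
move=> C0 bPhi bphi q.
pose r (h : A) (y : B) := \sum_d q (h, d) * phi (y - d).
have -> : \sum_z (\sum_w q w * tensor Phi phi (z - w)) ^+ 2 =
    \sum_y \sum_x (\sum_h r h y * Phi (x - h)) ^+ 2.
  rewrite exchange_big pair_bigA /=; apply: eq_bigr => -[x y] _ /=.
  congr (_ ^+ 2); transitivity (\sum_h \sum_d q (h, d) * (Phi (x - h) * phi (y - d))).
    by rewrite pair_bigA; apply: eq_bigr => -[].
  apply: eq_bigr => h _; rewrite mulr_suml; apply: eq_bigr => d _.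
  by rewrite -mulrA [phi _ * _]mulrC.
apply: (@le_trans _ _ (\sum_y C * \sum_h r h y ^+ 2)).
  by apply: ler_sum => y _; exact: bPhi.
rewrite -mulr_sumr -mulrA ler_wpM2l // exchange_big /=.
apply: (@le_trans _ _ (\sum_h D * \sum_d q (h, d) ^+ 2)).
  by apply: ler_sum => h _; exact: bphi.
rewrite -mulr_sumr pair_bigA /=.
by under eq_bigr => z _ do rewrite -surjective_pairing.
Qed.

End Convolution.

(** * Convolution with the modified Legendre symbol *)

Section QSignConvolution.
Variables (R : realFieldType) (F : finFieldType).
Hypothesis oddF : odd #|F|.
Local Notation chi := (@qchar R F).

Lemma spanning_qsign : spanning (@qsign R F).
Proof.
have F1 : (1 < #|F|)%N := finNzRing_gt1 F.
have N1 : (-1 : F) != 0 by rewrite oppr_eq0 oner_eq0.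
have s2 := qchar_sqr R N1; set s := chi (-1) in s2.
have sle : s <= 1 by nra.
have F1' : 1 < #|F|%:R :> R by rewrite ltr1n.
have D0 : #|F|%:R - s != 0 by rewrite gt_eqF //; lra.
pose a := (#|F|%:R - s)^-1.
(* Correlating [chi - s delta] with [qsign] cancels the [chi] terms, since [chi (- x) = s * chi x],
   and leaves [(#|F| - s) delta - 1]. The constant [1] correlates to [1] and removes the [-1]; [a]
   normalizes. *)
exists (fun h => a * (chi h - s * (h == 0)%:R + 1)) => x.
have chiN : chi (- x) = s * chi x by rewrite -mulN1r qcharM.
have E1 : \sum_h chi h * chi (x + h) = #|F|%:R * (x == 0)%:R - 1.
  by rewrite -sum_qchar_shift //; apply: eq_bigr => h _; rewrite [x + h]addrC.
have E2 : \sum_h chi h * (x + h == 0)%:R = s * chi x.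
  by under eq_bigr do rewrite addrC addr_eq0; rewrite sum_delta.
have E3 : \sum_h (h == 0)%:R * chi (x + h) = chi x.
  by under eq_bigr do rewrite mulrC; rewrite (sum_delta (fun h => chi (x + h))) addr0.
have E4 : \sum_h (h == 0)%:R * (x + h == 0)%:R = (x == 0)%:R :> R.
  under eq_bigr do rewrite mulrC.
  by rewrite (sum_delta (fun h => (x + h == 0)%:R)) addr0.
have E5 : \sum_h chi (x + h) = 0.
  rewrite -[RHS](sum_qchar R oddF).
  by rewrite [RHS](reindex_inj (@addrI _ x)).
have E6 : \sum_h (x + h == 0)%:R = 1 :> R.
  rewrite (bigD1 (- x)) //= subrr eqxx big1 ?addr0 // => h.
  by rewrite addrC addr_eq0 => /negPf->.
transitivity (a * (\sum_h chi h * chi (x + h) + \sum_h chi h * (x + h == 0)%:R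
  - s * (\sum_h (h == 0)%:R * chi (x + h) + \sum_h (h == 0)%:R * (x + h == 0)%:R)
  + (\sum_h chi (x + h) + \sum_h (x + h == 0)%:R))).
  rewrite -!big_split mulr_sumr -sumrB -big_split mulr_sumr /=.
  by apply: eq_bigr => h _; rewrite /qsign; ring.
rewrite E1 E2 E3 E4 E5 E6 /a; field.
by [].
Qed.

(** This replaces the modulus of Gauss sums: expanding the square and inserting the autocorrelation
    of [chi] gives exactly [#|F|] times the sum of [q ^+ 2], minus a square. *)
Lemma conv_bounded_qchar : conv_bounded chi #|F|%:R.
Proof.
move=> q.
have -> : \sum_x (\sum_h q h * chi (x - h)) ^+ 2 =
   \sum_h \sum_k q h * q k * \sum_x chi (x - h) * chi (x - k).
  transitivity (\sum_x \sum_h \sum_k q h * q k * (chi (x - h) * chi (x - k))).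
    apply: eq_bigr => x _; rewrite expr2 mulr_suml; apply: eq_bigr => h _.
    by rewrite mulr_sumr; apply: eq_bigr => k _; rewrite mulrACA.
  rewrite exchange_big; apply: eq_bigr => h _; rewrite exchange_big.
  by apply: eq_bigr => k _; rewrite mulr_sumr.
have E h k : \sum_x chi (x - h) * chi (x - k) = #|F|%:R * (k == h)%:R - 1.
  rewrite (reindex_inj (@addIr _ h)) /= [k == h]eq_sym -subr_eq0 -sum_qchar_shift //.
  by apply: eq_bigr => x _; rewrite addrK addrA.
have -> : \sum_h \sum_k q h * q k * \sum_x chi (x - h) * chi (x - k) =
   #|F|%:R * (\sum_h q h ^+ 2) - (\sum_h q h) ^+ 2.
  under eq_bigr => h _ do under eq_bigr => k _ do rewrite E mulrBr mulr1 mulrCA.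
  under eq_bigr => h _ do rewrite sumrB -mulr_sumr (sum_delta (fun k => q h * q k)).
  rewrite sumrB -mulr_sumr [(\sum_h q h) ^+ 2]expr2 mulr_suml.
  by under [X in _ - X]eq_bigr => h _ do rewrite -mulr_sumr.
by have := sqr_ge0 (\sum_h q h); lra.
Qed.

(* [(a + b)^2 <= (1 + z) a^2 + (1 + 1/z) b^2]: convolution with the delta part
   of [qsign] has norm [1], which is at most [z] times [sqrt #|F|]. *)
Lemma conv_bounded_qsign (z : R) : 0 < z -> 1 <= #|F|%:R * z ^+ 2 ->
  conv_bounded (@qsign R F) (#|F|%:R * (1 + z) ^+ 2).
Proof.
move=> z0 hz q.
have Q0 : 0 <= \sum_h q h ^+ 2 by apply: sumr_ge0 => h _; exact: sqr_ge0.
apply: (@le_trans _ _ ((1 + z) * \sum_x (\sum_h q h * chi (x - h)) ^+ 2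
                       + (1 + z^-1) * \sum_x q x ^+ 2)).
  rewrite !mulr_sumr -big_split; apply: ler_sum => x _ /=.
  have -> : \sum_h q h * qsign R (x - h) = \sum_h q h * chi (x - h) + q x.
    rewrite -[X in _ + X](sum_delta q x) -big_split; apply: eq_bigr => h _.
    by rewrite /qsign subr_eq0 [x == h]eq_sym mulrDr.
  set a := \sum_h _; set b := q x.
  have : 0 <= (z * a - b) ^+ 2 / z by rewrite divr_ge0 ?sqr_ge0 // ltW.
  have -> : (z * a - b) ^+ 2 / z = z * a ^+ 2 - 2 * a * b + z^-1 * b ^+ 2.
    by field; rewrite gt_eqF.
  by lra.
have := conv_bounded_qchar q.
set U := \sum_x _; set V := \sum_h _ in Q0 *; move=> UV.
have : (1 + z) * U <= (1 + z) * (#|F|%:R * V) by rewrite ler_pM2l //; lra.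
have : (1 + z^-1) * V <= (1 + z^-1) * (#|F|%:R * z ^+ 2 * V).
  rewrite ler_pM2l; last by rewrite addr_gt0 ?invr_gt0.
  by rewrite ler_peMl.
have -> : (1 + z^-1) * (#|F|%:R * z ^+ 2 * V) = (z ^+ 2 + z) * (#|F|%:R * V).
  by field; rewrite gt_eqF.
by lra.
Qed.

End QSignConvolution.

(** * The finite obstruction to approximate transitivity *)

Section FiniteObstruction.
Variable R : realFieldType.

(* Truncating the weight at [t] bounds its l2 norm by its l1 norm; only mass [c]
   lies where the weight is below [t]. *)
Lemma truncation_level (H : finType) (w : H -> R) (c : R) :
  (forall h, 0 <= w h) -> 0 < c -> c <= \sum_h w h ->
  exists t : R, [/\ 0 < t, c <= \sum_h Num.min (w h) t &
    \sum_(h | w h < t) w h <= c].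
Proof.
move=> w0 c0 cw.
have [h0 _] : exists h0 : H, true.
  have [|E] := pickP (@predT H); first by move=> h _; exists h.
  by move: cw; rewrite big_pred0 // leNgt c0.
(* The level [t] is the least value of [w] whose truncation retains mass [c]. Truncation at the next
   smaller value fails to, and it still contains all the mass lying below [t]. *)
pose G h := c <= \sum_k Num.min (w k) (w h).
have [hm _ hmax'] := @arg_maxP _ _ _ h0 predT w isT.
have hmax k : w k <= w hm by exact: hmax'.
have Gm : G hm.
  rewrite /G (le_trans cw) //; apply: ler_sum => k _.
  by rewrite le_min lexx hmax.
have [h1 G1 hmin] := @arg_minP _ _ _ hm G w Gm.
exists (w h1); split => //.
  rewrite lt_neqAle w0 andbT; apply/eqP => E; move: G1; rewrite /G -E leNgt.
  rewrite big1 ?c0 // => k _; exact/min_idPr.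
have [h2 lt2|no] := pickP (fun h => w h < w h1); last first.
  by rewrite big_pred0 ?ltW.
have [h3 lt3 h3max'] := @arg_maxP _ _ _ h2 (fun h => w h < w h1) w lt2.
have h3max k : w k < w h1 -> w k <= w h3 by exact: h3max'.
have : ~~ G h3 by apply/negP => /hmin; rewrite leNgt lt3.
rewrite /G -ltNge => /ltW; apply: le_trans.
rewrite [leRHS](bigID (fun h => w h < w h1)) /=.
rewrite -[leLHS]addr0; apply: lerD.
  by apply: ler_sum => k lt_k; rewrite le_min lexx h3max.
by apply: sumr_ge0 => k _; rewrite le_min !w0.
Qed.

Variables (H : finZmodType) (Phi : H -> R).
Hypothesis Phi2 : forall x, Phi x ^+ 2 = 1.
Notation Omega := (bool * H)%type.

(** In these coordinates the group moves only the second component, and the cocycle is carried by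
    the sign function [esign] instead. *)
Definition shift (z : Omega) (h : H) : Omega := (z.1, z.2 + h).
Definition esign (z : Omega) : R := (-1) ^+ z.1 * Phi z.2.

Lemma shift_inj h : injective (shift^~ h).
Proof. by move=> [b x] [c y] [-> /addIr ->]. Qed.

Lemma shiftK h : cancel (shift^~ h) (shift^~ (- h)).
Proof. by move=> [b x]; rewrite /shift /= addrK. Qed.

Lemma esign2 z : esign z ^+ 2 = 1.
Proof. by rewrite /esign exprMn Phi2 mulr1 sqrr_sign. Qed.

Lemma abs_esign z : `|esign z| = 1.
Proof. by apply/eqP; rewrite -sqr_norm_eq1 esign2. Qed.

(** Adjunction: it moves a convolution off [f] and onto the function that [f] is tested against. *)
Lemma sum_conv (w : H -> R) (g k : Omega -> R) :
  \sum_z k z * (\sum_h w h * g (shift z h)) =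
  \sum_z g z * (\sum_h w h * k (shift z (- h))).
Proof.
under eq_bigr do rewrite mulr_sumr.
under [RHS]eq_bigr do rewrite mulr_sumr.
rewrite exchange_big [RHS]exchange_big /=; apply: eq_bigr => h _.
rewrite [RHS](reindex_inj (@shift_inj h)) /=; apply: eq_bigr => z _.
by rewrite shiftK; ring.
Qed.

Lemma sum_conv1 (w : H -> R) (g : Omega -> R) :
  \sum_z \sum_h w h * g (shift z h) = (\sum_h w h) * \sum_z g z.
Proof.
transitivity (\sum_z 1 * (\sum_h w h * g (shift z h))).
  by apply: eq_bigr => z _; rewrite mul1r.
rewrite (sum_conv w g (fun=> 1)) mulrC mulr_suml; apply: eq_bigr => z _.
by congr (_ * _); apply: eq_bigr => h _; rewrite mulr1.
Qed.

Variable C : R.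
Hypothesis hC : C <= 16 / 9.
Hypothesis hPhi : conv_bounded Phi (C * #|H|%:R).

(* [Psi] is odd under the flip of the sign bit, so its large values on the
   positive side carry at most half of its second moment. *)
Lemma large_correlation (r : H -> R) (a : R) (Sd : pred Omega) : 0 < a ->
  (forall z, Sd z -> a <= \sum_h r h * esign (shift z (- h))) ->
  2 * #|Sd|%:R * a ^+ 2 <= C * #|{: Omega}|%:R * \sum_h r h ^+ 2.
Proof.
move=> a0 hS; pose Psi z := \sum_h r h * esign (shift z (- h)).
pose flip (z : Omega) : Omega := (~~ z.1, z.2).
have flipK : involutive flip by case=> b x; rewrite /flip negbK.
have Psi_flip z : Psi (flip z) = - Psi z.
  rewrite /Psi -sumrN; apply: eq_bigr => h _; rewrite /esign /=.
  by case: z.1; rewrite /= expr0 expr1; ring.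
have -> : C * #|{: Omega}|%:R * \sum_h r h ^+ 2 = 2 * (C * #|H|%:R * \sum_h r h ^+ 2).
  by rewrite card_prod card_bool natrM; ring.
apply: (@le_trans _ _ (\sum_z Psi z ^+ 2)); last first.
  have -> : \sum_z Psi z ^+ 2 = \sum_(b : bool) \sum_x Psi (b, x) ^+ 2.
    by rewrite pair_bigA; apply: eq_bigr => -[].
  have E b : \sum_x Psi (b, x) ^+ 2 = \sum_x (\sum_h r h * Phi (x - h)) ^+ 2.
    apply: eq_bigr => x _; rewrite /Psi /esign /shift /=.
    under eq_bigr do rewrite mulrCA.
    by rewrite -mulr_sumr exprMn sqrr_sign mul1r.
  by rewrite big_bool !E /=; have := hPhi r; lra.
have -> : 2 * #|Sd|%:R * a ^+ 2 = \sum_z ((Sd z)%:R + (Sd (flip z))%:R) * a ^+ 2.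
  rewrite -mulr_suml big_split /=.
  rewrite [X in _ + X](reindex_inj (inv_inj flipK)) /=.
  under [X in _ + X]eq_bigr do rewrite flipK.
  by rewrite -natr_sum -sum1_card big_mkcond /=; congr (_ * _); ring.
apply: ler_sum => z _.
have H1 := hS z; have H2 := hS (flip z); rewrite -/(Psi _) in H1.
rewrite -/(Psi _) Psi_flip in H2.
have P0 := sqr_ge0 (Psi z).
case: (Sd z) H1 => [/(_ isT) H1|_]; case: (Sd (flip z)) H2 => [/(_ isT) H2|_].
- by lra.
- by rewrite addr0 mul1r ler_sqr ?nnegrE; lra.
- by rewrite add0r mul1r -[Psi z ^+ 2]sqrrN ler_sqr ?nnegrE; lra.
- by rewrite addr0 mul0r.
Qed.

Lemma tiling_obstruction (P0 P1 : H -> R) (f : Omega -> R) (eps : R) :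
  0 < eps -> 1000 * 1000 * eps <= 1 ->
  (forall h, 0 <= P0 h) -> (forall h, 0 <= P1 h) -> (forall z, 0 <= f z) ->
  \sum_z `|(1 + esign z) / 2 - \sum_h P0 h * f (shift z h)|
    <= eps * #|{: Omega}|%:R ->
  \sum_z `|(1 - esign z) / 2 - \sum_h P1 h * f (shift z h)|
    <= eps * #|{: Omega}|%:R -> False.
Proof.
move=> eps0 eps1 P00 P10 f0 A0 A1; set M := #|{: Omega}|%:R in A0 A1.
have M0 : 0 < M.
  by rewrite ltr0n; apply/card_gt0P; exists (true, 0).
pose w h := P0 h + P1 h; pose q h := P0 h - P1 h.
have w0 h : 0 <= w h by rewrite addr_ge0.
have qw h : `|q h| <= w h.
  by rewrite ler_norml /q /w; have := P00 h; have := P10 h; lra.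
pose S := \sum_h w h; pose A := \sum_z f z.
have S0 : 0 <= S by apply: sumr_ge0.
have E1 : \sum_z `|1 - \sum_h w h * f (shift z h)| <= 2 * eps * M.
  apply: le_trans (_ : _ <= eps * M + eps * M) _; last by lra.
  apply: le_trans (lerD A0 A1); rewrite -big_split; apply: ler_sum => z _.
  apply: le_trans (ler_normD _ _); rewrite le_eqVlt; apply/orP; left; apply/eqP.
  congr `|_|; rewrite /w; under eq_bigr do rewrite mulrDl.
  by rewrite big_split /=; lra.
have E2 : \sum_z `|esign z - \sum_h q h * f (shift z h)| <= 2 * eps * M.
  apply: le_trans (_ : _ <= eps * M + eps * M) _; last by lra.
  apply: le_trans (lerD A0 A1); rewrite -big_split; apply: ler_sum => z _.
  apply: le_trans (ler_normB _ _); rewrite le_eqVlt; apply/orP; left; apply/eqP.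
  congr `|_|; rewrite /q; under eq_bigr do rewrite mulrBl.
  by rewrite sumrB; lra.
have sum1M : \sum_(z : Omega) 1 = M :> R by rewrite sumr_const.
have SA : `|M - S * A| <= 2 * eps * M.
  rewrite -sum1M -sum_conv1 -sumrB; apply: le_trans (ler_norm_sum _ _ _) _.
  by rewrite sum1M.
(* Pair the difference of the two approximations with [esign], whose square is [1], and pass to the
   adjoint. *)
have D : (1 - 2 * eps) * M <= \sum_z f z * \sum_h q h * esign (shift z (- h)).
  rewrite -sum_conv.
  have -> : \sum_z esign z * (\sum_h q h * f (shift z h)) =
    M - \sum_z esign z * (esign z - \sum_h q h * f (shift z h)).
    rewrite -sum1M -sumrB; apply: eq_bigr => z _.
    by have := esign2 z; rewrite expr2 mulrBr => ->; lra.
  have : \sum_z esign z * (esign z - \sum_h q h * f (shift z h)) <= 2 * eps * M.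
    apply: le_trans E2; apply: ler_sum => z _; apply: le_trans (ler_norm _) _.
    by rewrite normrM abs_esign mul1r.
  by lra.
(* [eta] is the share of the weight lost by truncation, [delta] the tolerance for a nearly maximal
   correlation. In the final count the covered set takes about 0.907, the truncation about 0.02 and
   the part of [f] off [Sd] at most [20000 * eps <= 0.02], so the total stays below 1. *)
pose eta : R := 1 / 50; pose delta : R := 1 / 100.
have Spos : 0 < S.
  rewrite lt_neqAle S0 andbT; apply/eqP => S00; move: SA.
  rewrite -S00 mul0r subr0 ger0_norm; last by lra.
  have : 1000 * 1000 * eps * M <= 1 * M by rewrite ler_pM2r.
  by lra.
have eS0 : 0 < eta * S by rewrite mulr_gt0 // /eta; lra.
have eSS : eta * S <= S by rewrite /eta; lra.
have [t [t0 tlo thi]] := truncation_level w0 eS0 eSS.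
pose m h := Num.min (w h) t; set mu := \sum_h _ in tlo.
(* Scaling [q] in the same ratio as [w] gives [|r| <= m <= t], so the squares of [r] sum to at most
   [t * mu]. Where [w] vanishes the quotient is [0] by convention, and [m] vanishes too. *)
pose r h := m h / w h * q h.
have m0 h : 0 <= m h by rewrite le_min w0 ltW.
have mw h : m h <= w h by rewrite ge_min lexx.
have mt h : m h <= t by rewrite ge_min lexx orbT.
have mu0 : 0 < mu by lra.
have ratio h : 0 <= m h / w h <= 1.
  rewrite divr_ge0 //=; have [->|wn0] := eqVneq (w h) 0; first by rewrite invr0 mulr0.
  by rewrite ler_pdivrMr ?mul1r // lt_neqAle eq_sym wn0 w0.
have mE h : m h / w h * w h = m h.
  have [w00|wn0] := eqVneq (w h) 0; last by rewrite divfK.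
  by rewrite w00 mulr0; apply/esym/eqP; rewrite eq_le m0 -{1}w00 mw.
have rm h : `|r h| <= m h.
  have /andP[k0 _] := ratio h.
  by rewrite normrM (ger0_norm k0) -[leRHS]mE ler_wpM2l.
pose Psi z := \sum_h r h * esign (shift z (- h)).
(* Before truncation the deficit is [S * A] minus the pairing in [D]. Truncation multiplies each
   nonnegative term [w - q * e] by a ratio in [[0, 1]], which cannot increase it. *)
have excess : \sum_z f z * (mu - Psi z) <= 4 * eps * M.
  apply: (@le_trans _ _ (\sum_z f z * (S - \sum_h q h * esign (shift z (- h))))).
    apply: ler_sum => z _; apply: ler_wpM2l => //.
    rewrite /mu /Psi /S -!sumrB; apply: ler_sum => h _; rewrite -/(m h).
    set e := esign _; have /andP[k0 k1] := ratio h.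
    rewrite -(mE h) /r; set k := m h / w h in k0 k1 *.
    have -> : k * w h - k * q h * e = k * (w h - q h * e) by ring.
    rewrite ler_piMl // subr_ge0 (le_trans _ (qw h)) // (le_trans (ler_norm _)) //.
    by rewrite normrM abs_esign mulr1.
  have -> : \sum_z f z * (S - \sum_h q h * esign (shift z (- h))) =
     S * A - \sum_z f z * \sum_h q h * esign (shift z (- h)).
    by rewrite /A mulr_sumr -sumrB; apply: eq_bigr => z _; ring.
  by move: SA; rewrite ler_norml => /andP[? ?]; lra.
pose Sd z := (1 - delta) * mu <= Psi z.
have offSd : delta * mu * \sum_(z | ~~ Sd z) f z <= 4 * eps * M.
  apply: le_trans excess; rewrite [leRHS](bigID Sd) /= -[leLHS]add0r; apply: lerD.
    apply: sumr_ge0 => z _; rewrite mulr_ge0 // subr_ge0; apply: ler_sum => h _.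
    apply: le_trans (ler_norm _) _; rewrite normrM abs_esign mulr1; exact: rm.
  rewrite mulr_sumr; apply: ler_sum => z; rewrite /Sd -ltNge => lt.
  by rewrite mulrC ler_wpM2l //; lra.
have d1 : 0 < (1 - delta) * mu by rewrite mulr_gt0 // /delta; lra.
have cardSd : 2 * #|Sd|%:R * ((1 - delta) * mu) ^+ 2 <= C * M * (t * mu).
  have C0 : 0 <= C.
    have := hPhi (fun=> 1); set X := \sum_x _; set n : R := _%:R.
    have n0 : 0 < n by rewrite ltr0n; apply/card_gt0P; exists 0.
    have X0 : 0 <= X by apply: sumr_ge0 => x _; exact: sqr_ge0.
    under eq_bigr do rewrite expr1n.
    rewrite sumr_const -/n => /(le_trans X0).
    by rewrite pmulr_lge0 // pmulr_lge0.
  apply: (le_trans (large_correlation (r := r) d1 _)) => //.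
  apply: ler_wpM2l; first by rewrite mulr_ge0 // ltW.
  rewrite mulr_sumr; apply: ler_sum => h _.
  rewrite -real_normK ?num_real // expr2; apply: ler_pM => //.
  exact: le_trans (rm h) (mt h).
pose L h := t <= w h.
have cardL : #|L|%:R * t <= mu.
  rewrite mulr_natl -sumr_const [leRHS](bigID L) /= -[leLHS]addr0; apply: lerD.
    by apply: ler_sum => h Lh; rewrite le_min lexx andbT.
  by apply: sumr_ge0 => h _; exact: m0.
(* The points whose value of the convolution can receive a contribution from a heavy [h] and from
   [f] on [Sd]. *)
pose E z := [exists h, L h && Sd (shift z h)].
have cardE : #|E|%:R <= #|L|%:R * #|Sd|%:R :> R.
  rewrite -natrM ler_nat -[#|E|]sum1_card big_mkcond /=.
  apply: (@leq_trans (\sum_z \sum_(h | L h) Sd (shift z h))%N).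
    apply: leq_sum => z _; rewrite unfold_in; case: ifP => // /existsP[h /andP[Lh Sh]].
    by rewrite (bigD1 h) //= Sh.
  rewrite exchange_big /= -sum1_card big_distrl /=; apply: leq_sum => h _.
  rewrite mul1n -sum1_card [leqRHS]big_mkcond [leqRHS](reindex_inj (@shift_inj h)) /=.
  apply: leq_sum => z _; rewrite -[_ \in Sd]/(Sd (shift z h)).
  by case: (Sd _).
(* The level [t] cancels: [#|L|] is at most [mu / t], while the bound on [#|Sd|] is proportional to
   [t / mu]. *)
have cardE2 : #|E|%:R <= C * M / (2 * (1 - delta) ^+ 2).
  have d2 : 0 < 2 * (1 - delta) ^+ 2 by rewrite /delta; lra.
  rewrite ler_pdivlMr //.
  apply: (@le_trans _ _ (#|L|%:R * #|Sd|%:R * (2 * (1 - delta) ^+ 2))).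
    by rewrite ler_pM2r.
  have tm : 0 < t * mu ^+ 2 by rewrite mulr_gt0 // exprn_gt0.
  rewrite -(ler_pM2r tm).
  have -> : #|L|%:R * #|Sd|%:R * (2 * (1 - delta) ^+ 2) * (t * mu ^+ 2) =
     #|L|%:R * t * (2 * #|Sd|%:R * ((1 - delta) * mu) ^+ 2) by ring.
  have -> : C * M * (t * mu ^+ 2) = mu * (C * M * (t * mu)) by ring.
  apply: ler_pM => //; first by rewrite mulr_ge0 // ltW.
  by rewrite mulr_ge0 ?sqr_ge0 // mulr_ge0.
have lower : M - #|E|%:R <= \sum_(z | ~~ E z) \sum_h w h * f (shift z h) + 2 * eps * M.
  have -> : M - #|E|%:R = \sum_(z | ~~ E z) 1.
    rewrite -sum1M (bigID E) /= sumr_const; set X := \sum_(_ | _) _.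
    by rewrite addrC addrK.
  apply: le_trans (_ : _ <= \sum_(z | ~~ E z) \sum_h w h * f (shift z h) +
     \sum_(z | ~~ E z) `|1 - \sum_h w h * f (shift z h)|) _.
    rewrite -big_split; apply: ler_sum => z _ /=.
    by have := ler_norm (1 - \sum_h w h * f (shift z h)); lra.
  rewrite lerD2l; apply: le_trans E1; rewrite [leRHS](bigID E) /=.
  by rewrite lerDr; apply: sumr_ge0.
(* Off [E] every term has either [shift z h] outside [Sd] or [h] outside [L]; the two losses are
   bounded separately. *)
have upper : \sum_(z | ~~ E z) \sum_h w h * f (shift z h) <=
    S * \sum_(z | ~~ Sd z) f z + eta * S * A.
  apply: (@le_trans _ _ (\sum_z (\sum_h w h * ((~~ Sd (shift z h))%:R * f (shift z h))
     + \sum_h (~~ L h)%:R * w h * f (shift z h)))).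
    rewrite [leRHS](bigID E) /= -[leLHS]add0r; apply: lerD.
      apply: sumr_ge0 => z _; apply: addr_ge0; apply: sumr_ge0 => h _;
        by rewrite !mulr_ge0.
    apply: ler_sum => z; rewrite negb_exists => /forallP nE.
    rewrite -big_split; apply: ler_sum => h _ /=.
    have := nE h; rewrite negb_and => /orP[->|->];
      rewrite ?mul1r ?lerDl ?lerDr !mulr_ge0 //.
  rewrite big_split /= (sum_conv1 w (fun z => (~~ Sd z)%:R * f z)).
  rewrite (sum_conv1 (fun h => (~~ L h)%:R * w h)); apply: lerD.
    rewrite ler_wpM2l // [leRHS]big_mkcond /=; apply: ler_sum => z _.
    by case: (Sd z); rewrite ?mul0r ?mul1r.
  rewrite ler_wpM2r //; first by apply: sumr_ge0.
  apply: le_trans thi; rewrite [leRHS]big_mkcond /=; apply: ler_sum => h _.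
  by rewrite /L -ltNge; case: ifP => _; rewrite ?mul0r ?mul1r.
have SA2 : S * A <= (1 + 2 * eps) * M.
  by move: SA; rewrite ler_norml => /andP[? ?]; lra.
have off2 : S * \sum_(z | ~~ Sd z) f z <= 4 * eps * M / (delta * eta).
  have de : 0 < delta * eta by rewrite /delta /eta; lra.
  rewrite ler_pdivlMr //; apply: le_trans offSd.
  set X := \sum_(_ | _) _; have X0 : 0 <= X by apply: sumr_ge0.
  have : delta * (eta * S) * X <= delta * mu * X.
    by rewrite ler_wpM2r // ler_pM2l // /delta; lra.
  by lra.
have epsM : 1000 * 1000 * eps * M <= 1 * M by rewrite ler_pM2r.
have CM : C * M <= 16 / 9 * M by rewrite ler_pM2r.
have E_ : #|E|%:R <= 16 / 9 * M / (2 * (1 - delta) ^+ 2).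
  apply: le_trans cardE2 _; rewrite ler_pM2r // invr_gt0 /delta; lra.
move: E_ off2 upper lower; rewrite /delta /eta; set X := \sum_(_ | _) _; set Y := \sum_(_ | _) _.
rewrite -[1 / 50 * S * A]mulrA.
have -> : 16 / 9 * M / (2 * (1 - 1 / 100) ^+ 2) = 16 / 9 * (5000 / 9801) * M.
  by field.
have -> : 4 * eps * M / (1 / 100 * (1 / 50)) = 20000 * (eps * M) by field.
have -> : 2 * eps * M = 2 * (eps * M) by ring.
move: SA2 epsM; rewrite mulrDl mul1r -!mulrA; set Z := eps * M.
move: (S * A) (S * Y) Z => U V Z.
by lra.
Qed.

End FiniteObstruction.

(** * Mixed radix cells of the line and the action on them *)

Section Levels.
Variables (R : realType) (p : nat -> nat).
Hypothesis p_prime : forall n, prime (p n).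
Hypothesis p_bound : forall n, (5 ^ (2 * n.+1) <= p n)%N.

Lemma p_gt0 n : (0 < p n)%N. Proof. exact: prime_gt0. Qed.

Lemma p_ge25 n : (25 <= p n)%N.
Proof.
by apply: leq_trans (p_bound n); rewrite mulnS expnD leq_pmulr ?expn_gt0.
Qed.

Lemma card_digit n : #|'F_(p n)| = p n. Proof. exact: card_Fp. Qed.

Lemma odd_digit n : odd #|'F_(p n)|.
Proof.
rewrite card_digit; case: (even_prime (p_prime n)) => // p2.
by have := p_ge25 n; rewrite p2.
Qed.

Fixpoint ncell0 (n : nat) : nat := if n is m.+1 then (ncell0 m * p m)%N else 1%N.

Definition ncell n := (2 * ncell0 n)%N.

Lemma ncell0_gt0 n : (0 < ncell0 n)%N.
Proof. by elim: n => //= n IH; rewrite muln_gt0 IH p_gt0. Qed.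

Lemma ncell_gt0 n : (0 < ncell n)%N.
Proof. by rewrite /ncell muln_gt0 ncell0_gt0. Qed.

Lemma ncellS n : ncell n.+1 = (ncell n * p n)%N.
Proof. by rewrite /ncell /= mulnA. Qed.

Lemma expn_ncell n : (2 ^ n < ncell n)%N.
Proof.
elim: n => // n IH; rewrite ncellS expnSr (@leq_ltn_trans (2 ^ n * p n)) //.
  by rewrite leq_pmul2l ?expn_gt0 // (leq_trans _ (p_ge25 n)).
by rewrite ltn_pmul2r ?p_gt0.
Qed.

Lemma card_dig n : #|dig p n| = ncell0 n.
Proof. by elim: n => [|n IH]; rewrite ?card_ord //= card_prod IH card_digit. Qed.

Lemma card_level n : #|{: bool * dig p n}| = ncell n.
Proof. by rewrite card_prod card_bool card_dig. Qed.

Fixpoint encd n : dig p n -> nat :=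
  if n is m.+1 then fun x => (encd x.1 * p m + (x.2 : nat))%N else fun=> 0%N.

Fixpoint decd n (i : nat) : dig p n :=
  if n is m.+1 return dig p n then (decd m (i %/ p m), (i%:R : 'F_(p m)))
  else 0.

(* The sign is the leading digit, so that the cells of level [n.+1] refine those
   of level [n] while the sign keeps its value. *)
Definition enc n (z : bool * dig p n) : nat := (z.1 * ncell0 n + encd z.2)%N.
Definition dec n (i : nat) : bool * dig p n := (odd (i %/ ncell0 n), decd n i).

Lemma digit_lt n (d : 'F_(p n)) : (d < p n)%N.
Proof. by have := ltn_ord d; rewrite [X in (_ < X)%N]Fp_cast. Qed.

Lemma natr_digit n (i : nat) : ((i%:R : 'F_(p n)) : nat) = (i %% p n)%N.
Proof. exact: val_Fp_nat. Qed.

Lemma encd_lt n (x : dig p n) : (encd x < ncell0 n)%N.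
Proof.
elim: n x => [|n IH] [] //= x d; have := IH x; have := digit_lt d; nia.
Qed.

Lemma enc_lt n (z : bool * dig p n) : (enc z < ncell n)%N.
Proof. by case: z => [[] x]; have := encd_lt x; rewrite /enc /ncell /=; lia. Qed.

(** The multiple of [ncell0 n] stands for the leading sign digit, which [decd] does not see. *)
Lemma encdK n (x : dig p n) k : decd n (k * ncell0 n + encd x)%N = x.
Proof.
elim: n x k => [|n IH] x k /=; first by rewrite [x]ord1.
case: x => x d /=; have dlt := digit_lt d.
rewrite mulnA addnA -mulnDl divnMDl ?p_gt0 // divn_small // addn0 IH.
congr (_, _); apply: val_inj => /=; rewrite natr_digit.
by rewrite modnMDl modn_small.
Qed.

Lemma encK n (z : bool * dig p n) : dec n (enc z) = z.
Proof.
case: z => b x; rewrite /dec /enc /= encdK divnMDl ?ncell0_gt0 //.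
by rewrite (divn_small (encd_lt x)) addn0; case: b.
Qed.

Lemma decK n i : (i < ncell n)%N -> enc (dec n i) = i.
Proof.
move=> lt.
have E : forall m j, encd (decd m j) = (j %% ncell0 m)%N.
  elim=> [|m IH] j /=; first by rewrite modn1.
  rewrite IH natr_digit [RHS](_ : _ = (j %/ p m %% ncell0 m * p m + j %% p m)%N) //.
  rewrite {1}(divn_eq j (p m)) {1}(divn_eq (j %/ p m) (ncell0 m)).
  rewrite mulnDl -mulnA -addnA modnMDl modn_small //.
  have := ltn_pmod (j %/ p m) (ncell0_gt0 m); have := ltn_pmod j (p_gt0 m); nia.
rewrite /enc /dec /= E {3}(divn_eq i (ncell0 n)); congr (_ * _ + _)%N.
have : (i %/ ncell0 n < 2)%N by rewrite ltn_divLR ?ncell0_gt0.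
by case: (i %/ _)%N => [|[]].
Qed.

Lemma dec_lift n i : dec n (i %/ p n) = ((dec n.+1 i).1, (dec n.+1 i).2.1).
Proof. by rewrite /dec /= mulnC divnMA. Qed.

Lemma enc_lift n (z : bool * dig p n) (d : 'F_(p n)) :
  enc ((z.1, (z.2, d)) : bool * dig p n.+1) = (enc z * p n + d)%N.
Proof. by rewrite /enc /= mulnDl mulnA addnA. Qed.

(** The formal product [Phi] cut off after [n] coordinates. *)
Fixpoint sgn_fun n : dig p n -> R :=
  if n is m.+1 then tensor (@sgn_fun m) (@qsign R 'F_(p m)) else fun=> 1.

Definition sgn_neg n (x : dig p n) : bool := sgn_fun x < 0.

Lemma sgn_fun2 n (x : dig p n) : sgn_fun x ^+ 2 = 1.
Proof.
elim: n x => [|n IH] x /=; first by rewrite expr1n.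
by rewrite /tensor exprMn IH qsign_sqr // mulr1.
Qed.

Lemma sgn_funE n (x : dig p n) : sgn_fun x = (-1) ^+ sgn_neg x.
Proof.
rewrite /sgn_neg; have /eqP := sgn_fun2 x.
by rewrite sqrf_eq1 => /orP[/eqP->|/eqP->]; [rewrite ltr10|rewrite ltrN10].
Qed.

(** The sign changes by [Phi (x + a) / Phi x], written additively on bits. At each finite level this
    cocycle is a coboundary, although [Phi] itself is only formal in the limit. *)
Definition cocycle_act n (a : dig p n) (z : bool * dig p n) : bool * dig p n :=
  (z.1 (+) sgn_neg z.2 (+) sgn_neg (z.2 + a), z.2 + a).

Lemma act0 n (z : bool * dig p n) : cocycle_act 0 z = z.
Proof. by case: z => b x; rewrite /cocycle_act /= addr0 addbK. Qed.

Lemma actD n (a b : dig p n) z : cocycle_act (a + b) z = cocycle_act a (cocycle_act b z).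
Proof.
case: z => c x; rewrite /cocycle_act /= [a + b]addrC addrA.
by congr (_, _); rewrite addbK.
Qed.

Lemma neg_lift n (x : dig p n) (d : 'F_(p n)) :
  sgn_neg ((x, d) : dig p n.+1) = sgn_neg x (+) (qsign R d < 0).
Proof.
rewrite /sgn_neg /= /tensor /= -/(sgn_neg x) sgn_funE.
have /eqP := qsign_sqr R d; rewrite sqrf_eq1 => /orP[]/eqP->;
  case: (sgn_neg x); rewrite ?mulr1 ?mulrN1 ?expr0 ?expr1 ?opprK ?ltr10 ?ltr01 ?ltrN10 //;
  by rewrite ltNge ler01.
Qed.

(** A coordinate that is not moved contributes equal factors to [Phi (x + a)] and [Phi x], which
    cancel. This is why the cocycle makes sense on the infinite product. *)
Lemma act_lift n (a : dig p n) (z : bool * dig p n) (d : 'F_(p n)) :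
  cocycle_act ((a, 0) : dig p n.+1) (z.1, (z.2, d)) =
  ((cocycle_act a z).1, ((cocycle_act a z).2, d)).
Proof.
case: z => b x; rewrite /cocycle_act /= [X in (_, X)](_ : _ = (x + a, d)); last first.
  by congr (_, _); exact: addr0.
have -> : ((x, d) + (a, 0) : dig p n.+1) = (x + a, d).
  by congr (_, _); exact: addr0.
rewrite (neg_lift x d) (neg_lift (x + a) d).
by congr (_, _); case: b; case: (sgn_neg x); case: (sgn_neg (x + a)); case: (_ < 0).
Qed.

(* Cells are 1-periodic, which makes [rotate] below a bijection of the whole line,
   although only [0, 1[ carries mass. *)
Definition kcell n (x : R) : nat :=
  Num.truncn ((x - (Num.floor x)%:~R) * (ncell n)%:R).

Definition cell n (x : R) : bool * dig p n := dec n (kcell n x).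

Lemma ncellR_gt0 n : 0 < (ncell n)%:R :> R. Proof. by rewrite ltr0n ncell_gt0. Qed.

Lemma kcellP n (x : R) : (kcell n x < ncell n)%N /\ exists2 t : R, 0 <= t < 1 &
  x = (Num.floor x)%:~R + ((kcell n x)%:R + t) / (ncell n)%:R.
Proof.
have M0 := ncellR_gt0 n; set y := (x - (Num.floor x)%:~R) * (ncell n)%:R.
have /andP[f1 f2] := Num.Theory.floor_itv x.
rewrite intrD in f2.
have y0 : 0 <= y by rewrite mulr_ge0 ?subr_ge0 // ltW.
have yM : y < (ncell n)%:R by rewrite gtr_pMl // ltrBlDl.
have /andP[t1 t2] := truncn_itv y0.
split; first by rewrite -(ltr_nat R); exact: le_lt_trans yM.
exists (y - (kcell n x)%:R).
  by rewrite subr_ge0 t1 /= ltrBlDl -natr1 addrC in t2 *.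
by rewrite [_ + (y - _)]addrC subrK /y mulfK ?gt_eqF // addrC subrK.
Qed.

Lemma kcell_uniq n (z : int) (k : nat) (t : R) : (k < ncell n)%N -> 0 <= t < 1 ->
  let x := z%:~R + (k%:R + t) / (ncell n)%:R in
  Num.floor x = z /\ kcell n x = k.
Proof.
move=> kn /andP[t0 t1] x; have M0 := ncellR_gt0 n.
have k1 : k%:R + 1 <= (ncell n)%:R :> R by rewrite natr1 ler_nat.
have k0 : 0 <= k%:R :> R by rewrite ler0n.
have f : Num.floor x = z.
  apply: floor_def; rewrite /x intrD lerDl ltrD2l divr_ge0 ?(ltW M0) ?addr_ge0 //=.
  by rewrite ltr_pdivrMr // mul1r; lra.
split => //; rewrite /kcell f /x addrC addKr divfK ?gt_eqF //.
by apply: truncn_def; rewrite -natr1; lra.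
Qed.

Lemma cell_lift n x : cell n x = ((cell n.+1 x).1, (cell n.+1 x).2.1).
Proof.
rewrite /cell -dec_lift; congr dec.
have [kn [t /andP[t0 t1] E]] := kcellP n.+1 x; have p0 := p_gt0 n.
have pR : 0 < (p n)%:R :> R by rewrite ltr0n.
pose k := kcell n.+1 x; rewrite -/k in kn E *.
have lt := ltn_pmod k p0.
(* The last digit together with the position in the fine cell gives the position in the coarse
   cell. *)
have := @kcell_uniq n (Num.floor x) (k %/ p n) (((k %% p n)%:R + t) / (p n)%:R).
rewrite (_ : _ + _ / (ncell n)%:R = x) => [H|].
  apply: (H _ _).2; first by rewrite ltn_divLR // -ncellS.
  rewrite divr_ge0 ?addr_ge0 ?ler0n // ?(ltW pR) //= ltr_pdivrMr // mul1r.
  by move: lt; rewrite -(ler_nat R) -natr1; lra.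
rewrite [RHS]E; congr (_ + _); rewrite ncellS natrM {3}(divn_eq k (p n)) natrD natrM.
have := ncellR_gt0 n; move: (ncell n)%:R => M M0; field.
by rewrite !gt_eqF.
Qed.

(** A piecewise translation that carries each cell onto its image and keeps both the offset inside
    the cell and the integer part. *)
Definition rotate n (a : dig p n) (x : R) : R :=
  x + ((enc (cocycle_act a (cell n x)))%:R - (kcell n x)%:R) / (ncell n)%:R.

Lemma rotE n (a : dig p n) (x : R) : exists2 t : R, 0 <= t < 1 &
  x = (Num.floor x)%:~R + ((enc (cell n x))%:R + t) / (ncell n)%:R /\
  rotate a x = (Num.floor x)%:~R + ((enc (cocycle_act a (cell n x)))%:R + t) / (ncell n)%:R.
Proof.
have [kn [t t01 E]] := kcellP n x; exists t => //.
rewrite /rotate /cell decK //; split => //.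
by rewrite {1}E -addrA -mulrDl; congr (_ + _ / _); ring.
Qed.

Lemma kcell_rot n (a : dig p n) x :
  Num.floor (rotate a x) = Num.floor x /\ kcell n (rotate a x) = enc (cocycle_act a (cell n x)).
Proof.
by have [t t01 [_ ->]] := rotE a x; apply: kcell_uniq => //; exact: enc_lt.
Qed.

Lemma cell_rot n (a : dig p n) x : cell n (rotate a x) = cocycle_act a (cell n x).
Proof. by rewrite {1}/cell (kcell_rot a x).2 encK. Qed.

Lemma rot0 n x : rotate (0 : dig p n) x = x.
Proof.
rewrite /rotate act0 /cell decK ?subrr ?mul0r ?addr0 //.
by have [] := kcellP n x.
Qed.

Lemma rotD n (a b : dig p n) x : rotate (a + b) x = rotate a (rotate b x).
Proof.
rewrite [rotate a _]/rotate cell_rot -actD (kcell_rot b x).2 /rotate.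
by rewrite -addrA -mulrDl; congr (_ + _ / _); ring.
Qed.

(** When the last digit stays fixed, the subcells of a cell move rigidly with it, so the finite
    levels define one map. *)
Lemma rot_lift n (a : dig p n) x : rotate ((a, 0) : dig p n.+1) x = rotate a x.
Proof.
have kE m : kcell m x = enc (cell m x) by rewrite /cell decK //; have [] := kcellP m x.
rewrite /rotate !kE; have := cell_lift n x; case: (cell n.+1 x) => b [y d] /= ->.
rewrite (act_lift a (b, y) d) !enc_lift (enc_lift (b, y) d) ncellS.
move: (enc _) (enc (b, y)) (ncell n) (ncellR_gt0 n) => u v M M0.
have : 0 < (p n)%:R :> R by rewrite ltr0n p_gt0.
move: (p n) (nat_of_ord d) => P k P0.
congr (_ + _); rewrite !natrD !natrM; field.
by rewrite !gt_eqF.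
Qed.

Fixpoint digits_of n (g : nat -> nat) : dig p n :=
  if n is m.+1 return dig p n then (digits_of m g, ((g m)%:R : 'F_(p m))) else 0.

Lemma res_add n g h : digits_of n (fun k => (g k + h k) %% p k)%N = digits_of n g + digits_of n h.
Proof.
elim: n => [|n IH] /=; first by rewrite addr0.
rewrite IH; congr (_, _); rewrite -natrD; apply: ord_inj.
by rewrite (natr_digit n _) (natr_digit n _) modn_mod.
Qed.

Lemma res_ext n g h : (forall k, (k < n)%N -> g k = h k) -> digits_of n g = digits_of n h.
Proof.
elim: n => //= n IH gh; rewrite gh // IH // => k kn.
exact: gh (ltnW kn).
Qed.

Lemma res_surj n (a : dig p n) : exists g : nat -> nat,
  [/\ forall k, (g k < p k)%N, forall k, (n <= k)%N -> g k = 0%N & digits_of n g = a].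
Proof.
elim: n a => [|n IH] a.
  by exists (fun=> 0%N); split=> [k||]; rewrite ?p_gt0 // [a]ord1.
case: a => a d; have [g [g1 g2 g3]] := IH a.
exists (fun k => if k == n then (d : nat) else g k); split => [k|k nk|/=].
- by case: eqP => [->|_]; rewrite ?digit_lt.
- by case: eqP => [kn|_]; [rewrite kn ltnn in nk|rewrite g2 // ltnW].
- rewrite eqxx; congr (_, _); last by apply: ord_inj; rewrite natr_digit modn_small ?digit_lt.
  by rewrite -g3; apply: res_ext => k kn; rewrite (ltn_eqF kn).
Qed.

Lemma rot_res n m g x : (n <= m)%N -> (forall k, (n <= k)%N -> g k = 0%N) ->
  rotate (digits_of m g) x = rotate (digits_of n g) x.
Proof.
move=> /subnKC <- g0; elim: (m - n)%N => [|k IH]; first by rewrite addn0.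
by rewrite addnS /= g0 ?leq_addr // rot_lift.
Qed.

End Levels.

(** * Measure preservation *)

Section FiberSum.
Context d (T : measurableType d) (R : realType).
Variables (mu : {measure set T -> \bar R}) (I : finType) (c : T -> I).
Hypothesis mc : forall z, measurable (c @^-1` [set z]).

Lemma bigsetU_fibers :
  \big[setU/set0]_(z <- index_enum I) (c @^-1` [set z]) = setT.
Proof.
rewrite -bigcup_seq; apply/seteqP; split => // x _.
by exists (c x) => //=; rewrite mem_index_enum.
Qed.

Lemma trivIset_fibers (D : set I) : trivIset D (fun z => c @^-1` [set z]).
Proof. by move=> y z _ _ [x /= [-> ->]]. Qed.

Lemma measure_fibers (A : set T) : measurable A ->
  mu A = (\sum_(z : I) mu (A `&` c @^-1` [set z]))%E.
Proof.
move=> mA; rewrite -{1}[A]setIT -bigsetU_fibers -bigcup_seq setI_bigcupr.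
rewrite measure_fin_bigcup.
- by rewrite -fsbig_seq // index_enum_uniq.
- exact: finite_seq.
- apply: trivIset_setIl; exact: trivIset_fibers.
- by move=> z _; exact: measurableI.
Qed.

Lemma ge0_integral_fibers (f : T -> \bar R) : measurable_fun [set: T] f ->
  (forall x, 0 <= f x)%E ->
  (\int[mu]_x f x = \sum_(z : I) \int[mu]_(x in c @^-1` [set z]) f x)%E.
Proof.
move=> mf f0; rewrite -bigsetU_fibers ge0_integral_bigsetU //.
- exact: index_enum_uniq.
- exact: trivIset_fibers.
- by rewrite bigsetU_fibers.
Qed.

End FiberSum.

(** The translated measure agrees with Lebesgue measure on half-open intervals, and these determine
    it. *)
Lemma lebesgue_measure_shift (R : realType) (c : R) (A : set (measurableTypeR R)) :
  measurable A ->
  lebesgue_measure ((fun x : measurableTypeR R => x + c) @^-1` A) =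
  lebesgue_measure A :> \bar R.
Proof.
move=> mA.
have ms : measurable_fun [set: measurableTypeR R]
    ((fun x => x + c) : measurableTypeR R -> measurableTypeR R).
  exact: measurable_funD.
pose sh := (fun x => x + c) : measurableTypeR R -> measurableTypeR R.
rewrite -[LHS]/(pushforward lebesgue_measure sh A).
apply/esym/lebesgue_measure_unique => //= _ [[a b] _ <-].
rewrite /pushforward.
have -> : sh @^-1` `]a, b]%classic = `]a - c, b - c]%classic.
  apply/seteqP; split => x /=; rewrite !in_itv /=;
    by rewrite ltrBlDr lerBrDr.
rewrite !lebesgue_measure_itv /= !lte_fin ltrD2r.
by case: ifP => // _; rewrite -!EFinB; congr _%:E; ring.
Qed.

Section UnitInterval.
Variables (R : realType) (p : nat -> nat).
Hypothesis p_prime : forall n, prime (p n).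
Hypothesis p_bound : forall n, (5 ^ (2 * n.+1) <= p n)%N.

Notation X := (measurableTypeR R).
Notation mu := (uniform_prob (@ltr01 R)).
Notation cellp := (@cell R p).
Notation kcellp := (@kcell R p).
Notation unitI := (`[0, 1[%classic : set X).

(** The uniform law lives on the closed interval, whereas the cells tile the half-open one; the
    endpoint is null. *)
Lemma uniform_lebesgue (A : set X) : measurable A ->
  mu A = lebesgue_measure (A `&` unitI).
Proof.
move=> mA; rewrite /uniform_prob integral_uniform_pdf.
have mI : measurable (A `&` `[0, 1]) by exact: measurableI.
transitivity (lebesgue_measure (A `&` `[0, 1])).
  rewrite -(mul1e (lebesgue_measure _)) -integral_cst //.
  apply: eq_integral => x; rewrite inE => -[_ /=]; rewrite in_itv /= => x01.
  by rewrite /uniform_pdf x01 subr0 invr1.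
have -> : `[0, 1]%classic = unitI `|` [set 1] :> set X.
  apply/seteqP; split => x /=; rewrite !in_itv /=.
    by move=> /andP[-> ]; rewrite le_eqVlt => /orP[/eqP ->|->]; [right|left].
  by move=> [/andP[-> /ltW]|->] //; rewrite ler01 lexx.
rewrite setIUr measureU //=; first last.
- apply/seteqP; split => x //= -[[_ ]]; rewrite in_itv /= => /andP[_ x1] [_ xE].
  by rewrite xE ltxx in x1.
- exact: measurableI.
- exact: measurableI.
rewrite [X in (_ + X)%E](_ : _ = 0%E) ?adde0 //.
apply/eqP; rewrite -measure_le0 -(lebesgue_measure_set1 (1 : R)).
by apply: le_measure; rewrite ?inE //; exact: measurableI.
Qed.

Lemma measurable_floorR :
  measurable_fun [set: X] (fun x : X => (Num.floor x)%:~R : R).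
Proof.
apply: nondecreasing_measurable => // x y xy.
by rewrite ler_int Num.Theory.floor_ge_int; apply: le_trans xy; case/andP: (floor_itv x).
Qed.

Lemma measurable_kcell n :
  measurable_fun [set: X] (fun x : X => (kcellp n x)%:R : R).
Proof.
have -> : (fun x : X => (kcellp n x)%:R : R) =
   (fun y => (Num.truncn y)%:R : R) \o
   (fun x : X => (x - (Num.floor x)%:~R) * (ncell p n)%:R) by [].
apply: measurableT_comp.
  apply: nondecreasing_measurable => // x y xy.
  by rewrite ler_nat truncn_le_nat (le_lt_trans xy) // -truncn_le_nat.
apply: measurable_funM => //; apply: measurable_funB => //.
exact: measurable_floorR.
Qed.

(** Every preimage is a countable union of level sets of [kcell], so [F] may be arbitrary. *)
Lemma measurable_cell n d' (T : measurableType d') (F : bool * dig p n -> T) :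
  measurable_fun [set: X] (fun x : X => F (cellp n x)).
Proof.
move=> _ Y mY; rewrite setTI.
have -> : (fun x : X => F (cellp n x)) @^-1` Y =
    \bigcup_(k in [set k | F (dec p n k) \in Y])
      ((fun x : X => (kcellp n x)%:R : R) @^-1` [set k%:R]).
  apply/seteqP; split => [x /= Fx|x [k /= FY /eqP]].
    by exists (kcellp n x) => //=; rewrite inE.
  by rewrite eqr_nat => /eqP E; rewrite /cell E -[Y _]/(Y (F (dec p n k))) -in_setE.
apply: bigcup_measurable => k _.
by rewrite -[X in measurable X]setTI; exact: measurable_kcell.
Qed.

Lemma measurable_fiber n z : measurable ((cellp n : X -> _) @^-1` [set z]).
Proof.
rewrite (_ : _ @^-1` _ = (fun x : X => cellp n x == z) @^-1` [set true]).
  rewrite -[X in measurable X]setTI.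
  exact: (measurable_cell (fun w => w == z)).
by apply/seteqP; split => x /= /eqP.
Qed.

Definition jump n (a : dig p n) (z : bool * dig p n) : R :=
  ((enc (cocycle_act R a z))%:R - (enc z)%:R) / (ncell p n)%:R.

Lemma measurable_rot n (a : dig p n) : measurable_fun [set: X] (@rotate R p n a : X -> X).
Proof.
rewrite (_ : @rotate R p n a = fun x => x + ((enc (cocycle_act R a (cellp n x)))%:R -
  (enc (cellp n x))%:R) / (ncell p n)%:R); last first.
  apply/funext => x; rewrite /rotate /cell decK //.
  by have [] := kcellP p_prime n x.
apply: measurable_funD => //.
exact: (measurable_cell (jump a)).
Qed.

Lemma rot_jump n (a : dig p n) x : rotate a x = x + jump a (cellp n x).
Proof. by rewrite /rotate /jump /cell decK //; have [] := kcellP p_prime n x. Qed.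

Lemma jumpN n (a : dig p n) z : jump (- a) (cocycle_act R a z) = - jump a z.
Proof. by rewrite /jump -actD addNr act0 -mulNr opprB. Qed.

Lemma floor_unitI (x : R) : unitI x <-> Num.floor x = 0.
Proof.
rewrite /= in_itv /=; split => [x01|E].
  by apply: floor_def; rewrite mulr0z add0r mulr1z.
by have := floor_itv x; rewrite E mulr0z add0r mulr1z.
Qed.

(** Split by cells: on each one [rotate a] is a translation onto the image cell, and [cocycle_act a]
    permutes the cells. *)
Lemma rot_mp n (a : dig p n) (A : set X) : measurable A ->
  mu ((@rotate R p n a : X -> X) @^-1` A) = mu A.
Proof.
move=> mA.
have mrA : measurable ((@rotate R p n a : X -> X) @^-1` A).
  by rewrite -[X in measurable X]setTI; exact: measurable_rot.
have fib B : measurable B -> mu B =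
    (\sum_(z : bool * dig p n) 
      lebesgue_measure (B `&` (unitI `&` (cellp n : X -> _) @^-1` [set z])))%E.
  move=> mB; rewrite uniform_lebesgue // (measure_fibers _ (@measurable_fiber n)).
    by apply: eq_bigr => z _; rewrite setIA.
  exact: measurableI.
rewrite (fib _ mrA) (fib _ mA).
have act_inj : injective (@cocycle_act R p n a).
  by apply: (can_inj (g := @cocycle_act R p n (- a))) => z; rewrite -actD addNr act0.
rewrite [RHS](reindex_inj act_inj) /=; apply: eq_bigr => z _.
rewrite -[RHS](lebesgue_measure_shift (jump a z)); last first.
  by apply: measurableI => //; apply: measurableI => //; exact: measurable_fiber.
congr (lebesgue_measure _); apply/seteqP; split => x.
  move=> [Ax [x01 xz]]; move: Ax; rewrite /= rot_jump xz => Ax.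
  have E : x + jump a z = rotate a x by rewrite rot_jump xz.
  split => //; rewrite E; split; last by rewrite /= cell_rot // xz.
  by apply/floor_unitI; rewrite (kcell_rot p_prime a x).1; apply/floor_unitI.
move=> [Ax [x01 xz]].
have E : x = rotate (- a) (x + jump a z).
  by rewrite rot_jump xz jumpN addrK.
have cx : cellp n x = z.
  by rewrite E cell_rot // xz -actD addNr act0.
split; first by rewrite /= rot_jump cx.
split => //; apply/floor_unitI; rewrite E (kcell_rot p_prime _ _).1.
exact/floor_unitI.
Qed.

Lemma fiberE n z : unitI `&` (cellp n : X -> _) @^-1` [set z] =
  `[(enc z)%:R / (ncell p n)%:R, (enc z).+1%:R / (ncell p n)%:R[%classic.
Proof.
have M0 := ncellR_gt0 R p_prime n.
apply/seteqP; split => x /=.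
  move=> [x01 xz]; have [kn [t /andP[t0 t1] E]] := kcellP p_prime n x.
  rewrite in_itv /= E (floor_unitI x).1 // mulr0z add0r -xz /cell decK //.
  by rewrite ler_pM2r ?invr_gt0 // ltr_pM2r ?invr_gt0 // lerDl t0 -natr1 ltrD2l.
rewrite in_itv /= ler_pdivrMr // ltr_pdivlMr // -natr1 => /andP[x0 x1].
have E : x = (0 : int)%:~R + ((enc z)%:R + (x * (ncell p n)%:R - (enc z)%:R)) / (ncell p n)%:R.
  by rewrite mulr0z add0r addrC subrK mulfK ?gt_eqF.
have [] := kcell_uniq p_prime 0 (enc_lt p_prime z) (t := x * (ncell p n)%:R - (enc z)%:R).
  by rewrite subr_ge0 x0 ltrBlDl.
rewrite -E => f0 k; split; first exact/floor_unitI.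
by rewrite /cell k encK.
Qed.

Lemma mu_fiber n z : mu ((cellp n : X -> _) @^-1` [set z]) = ((ncell p n)%:R^-1)%:E.
Proof.
have M0 := ncellR_gt0 R p_prime n.
rewrite uniform_lebesgue; last exact: measurable_fiber.
rewrite setIC fiberE lebesgue_measure_itv /= lte_fin ltr_pM2r ?invr_gt0 //.
rewrite ltr_nat ltnSn -EFinB -mulrBl -natr1 addrAC subrr add0r.
by rewrite mul1r.
Qed.

End UnitInterval.

(** * Failure of approximate transitivity *)

Section Action.
Variables (R : realType) (p : nat -> nat).
Hypothesis p_prime : forall n, prime (p n).
Hypothesis p_bound : forall n, (5 ^ (2 * n.+1) <= p n)%N.

Notation X := (measurableTypeR R).
Notation mu := (uniform_prob (@ltr01 R)).
Notation cellp := (@cell R p).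
Notation fiber n z := ((cellp n : X -> _) @^-1` [set z]).

(** Each coordinate costs [(1 + 5^-(k+1)) ^+ 2] beyond the ideal constant, and the product of these
    factors stays below [16 / 9]. *)
Lemma conv_bounded_sgn_fun n :
  conv_bounded (sgn_fun R (p:=p) (n:=n)) (16 / 9 * #|dig p n|%:R).
Proof.
pose Y n : R := \prod_(k < n) (1 + 5^-1 ^+ k.+1) ^+ 2.
have Y0 m : 0 <= Y m by apply: prodr_ge0 => k _; exact: sqr_ge0.
suff H : conv_bounded (sgn_fun R (p:=p) (n:=n)) (Y n * #|dig p n|%:R).
  have YB : Y n <= 16 / 9.
    have Z m : 0 < (5^-1 : R) ^+ m <= 1.
      by rewrite exprn_gt0 ?invr_gt0 //= exprn_ile1 ?invr_ge0 // invf_le1 // ler1n.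
    (* A sharper bound that passes through the induction: it equals [1] at [m = 0] and increases to
       [16 / 9]. *)
    suff B m : Y m <= (4 / (3 + 5^-1 ^+ m)) ^+ 2.
      apply: le_trans (B n) _; have /andP[z0 _] := Z n.
      have -> : 16 / 9 = (4 / 3) ^+ 2 :> R by field.
      have z3 : 0 < 3 + (5^-1 : R) ^+ n by lra.
      rewrite ler_sqr ?nnegrE ?divr_ge0 ?(ltW z3) //.
      by rewrite ler_pM2l // lef_pV2 ?posrE //; lra.
    elim: m => [|m IH]; first by rewrite /Y big_ord0 expr0 (_ : 4 / (3 + 1) = 1) ?expr1n //; field.
    rewrite /Y big_ord_recr /= -/(Y m).
    apply: le_trans (ler_wpM2r (sqr_ge0 _) IH) _.
    have /andP[z0 z1] := Z m; rewrite [5^-1 ^+ m.+1]exprSr -exprMn; set z := _ ^+ m in z0 z1 *.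
    have D1 : 0 < 3 + z by lra.
    have D2 : 0 < 3 + z / 5 by lra.
    have D3 : 0 <= 1 + z / 5 by lra.
    rewrite ler_sqr ?nnegrE ?mulr_ge0 ?divr_ge0 ?invr_ge0 ?(ltW D1) ?(ltW D2) //.
    rewrite mulrAC ler_pdivrMr // mulrAC ler_pdivlMr //; nra.
  move=> q; apply: le_trans (H q) _; apply: ler_wpM2r.
    by apply: sumr_ge0 => h _; exact: sqr_ge0.
  by rewrite ler_wpM2r.
elim: n => [|n IH].
  move=> q; rewrite /Y big_ord0 card_ord mul1r mul1r.
  by rewrite !big_ord1 mulr1.
rewrite /Y big_ord_recr /= card_prod natrM -/(Y n).
have -> : Y n * (1 + 5^-1 ^+ n.+1) ^+ 2 * (#|dig p n|%:R * #|'F_(p n)|%:R) =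
   (Y n * #|dig p n|%:R) * (#|'F_(p n)|%:R * (1 + 5^-1 ^+ n.+1) ^+ 2) by ring.
apply: conv_bounded_tensor => //; first by rewrite mulr_ge0.
(* With [z = 5^-(n+1)], the side condition is exactly the assumed growth of [p n]. *)
apply: conv_bounded_qsign; first exact: odd_digit.
  by rewrite exprn_gt0 // invr_gt0.
rewrite card_digit // -exprM mulnC exprVn ler_pdivlMr ?exprn_gt0 // mul1r.
by rewrite -natrX ler_nat.
Qed.

(* Outside the group, that is when [g] has infinite support, [depth] is [0]. *)
Definition depth (g : nat -> nat) : nat :=
  if pselect (exists n, forall k, (n <= k)%N -> g k = 0%N) is left h
  then projT1 (cid h) else 0%N.

Definition Tact (g : nat -> nat) (x : X) : X := rotate (digits_of p (depth g) g) x.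

(** All levels beyond the support give the same map, so [Tact] can be computed at any of them. *)
Lemma TactE g n : (forall k, (n <= k)%N -> g k = 0%N) ->
  Tact g = rotate (digits_of p n g).
Proof.
move=> gn; have dP : forall k, (depth g <= k)%N -> g k = 0%N.
  rewrite /depth; case: pselect => [h|]; first by case: cid.
  by case; exists n.
apply/funext => x; rewrite /Tact.
rewrite -(rot_res p_prime x (leq_maxl (depth g) n) dP).
by rewrite -(rot_res p_prime x (leq_maxr (depth g) n) gn).
Qed.

Lemma common_depth s (g : nat -> nat -> nat) : (forall k, (k < s)%N -> Gel p (g k)) ->
  exists n, forall k i, (k < s)%N -> (n <= i)%N -> g k i = 0%N.
Proof.
elim: s => [|s IH] hg; first by exists 0%N.
have [k ks|n hn] := IH; first exact: hg (ltnW _).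
have [_ [m hm]] := hg s (ltnSn s).
exists (maxn n m) => k i; rewrite ltnS leq_eqVlt => /orP[/eqP->|ks].
  by move=> le; apply: hm; apply: leq_trans le; exact: leq_maxr.
by move=> le; apply: hn => //; apply: leq_trans le; exact: leq_maxl.
Qed.

Lemma mp_action_Tact : mp_action p mu Tact.
Proof.
split; [|split].
- move=> g [_ [n gn]]; rewrite (TactE gn); split; [|split].
  + exact: measurable_rot.
  + exists (rotate (- digits_of p n g)); split; [|split].
    * by move=> x; rewrite -rotD // addNr rot0.
    * by move=> x; rewrite -rotD // addrN rot0.
    * exact: measurable_rot.
  + by move=> A mA; exact: rot_mp.
- by apply/funext => x; rewrite (@TactE _ 0%N) //= rot0.
- move=> g h hg hh.
  have [n hn] := common_depth (s := 2) (g := fun k => if k == 0%N then g else h)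
    (fun k _ => match k with 0%N => hg | _ => hh end).
  have gn k : (n <= k)%N -> g k = 0%N := hn 0%N k isT.
  have hn' k : (n <= k)%N -> h k = 0%N := hn 1%N k isT.
  rewrite (TactE gn) (TactE hn') (@TactE _ n); last first.
    by move=> k nk; rewrite /Gadd gn // hn' // mod0n.
  by apply/funext => x; rewrite /Gadd res_add //= rotD.
Qed.

Lemma ge0_integral_rot n (a : dig p n) (A : set X) (f : X -> \bar R) :
  measurable A -> measurable_fun [set: X] f -> (forall x, 0 <= f x)%E ->
  (\int[mu]_(x in (rotate a : X -> X) @^-1` A) f (rotate a x) = \int[mu]_(x in A) f x)%E.
Proof.
move=> mA mf f0.
rewrite -(@ge0_integral_pushforward _ _ _ _ _ (rotate a : X -> X)) //.
- apply: eq_measure_integral => [|mr B mB _]; first exact: measurable_rot.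
  exact: rot_mp.
- exact: measurable_rot.
- exact: measurable_funTS.
Qed.

Lemma integrable_rot n (a : dig p n) (f : X -> R) :
  mu.-integrable [set: X] (EFin \o f) ->
  mu.-integrable [set: X] (EFin \o (f \o rotate a)).
Proof.
move=> /integrableP[/measurable_EFinP mf fi]; apply/integrableP.
split; first by apply/measurable_EFinP; apply: measurableT_comp => //; exact: measurable_rot.
have mf' : measurable_fun [set: X] (fun x => `|(f x)%:E|%E).
  by apply: measurableT_comp => //; exact/measurable_EFinP.
have := ge0_integral_rot a measurableT mf' (fun x => abse_ge0 _).
by rewrite preimage_setT => ->.
Qed.

Lemma rot_fiber n (a : dig p n) z :
  (rotate a : X -> X) @^-1` fiber n (cocycle_act R a z) = fiber n z.
Proof.
apply/seteqP; split => x /=; rewrite cell_rot //; last by move=> ->.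
by move=> /(congr1 (cocycle_act R (- a))); rewrite -!actD addNr !act0.
Qed.

Lemma Rintegral_rot n (a : dig p n) z (f : X -> R) :
  mu.-integrable [set: X] (EFin \o f) -> (forall x, 0 <= f x) ->
  \int[mu]_(x in fiber n z) f (rotate a x) =
  \int[mu]_(x in fiber n (cocycle_act R a z)) f x.
Proof.
move=> /integrableP[mf _] f0; congr fine.
have f0' x : (0 <= (f x)%:E)%E by rewrite lee_fin.
by rewrite -(ge0_integral_rot a (measurable_fiber _) mf f0') rot_fiber.
Qed.

Lemma Rintegral_sum (n : nat) (D : set X) (c : nat -> R) (f : nat -> X -> R) :
  measurable D -> (forall k, mu.-integrable D (EFin \o f k)) ->
  mu.-integrable D (EFin \o (fun x => \sum_(k < n) c k * f k x)) /\
  \int[mu]_(x in D) (\sum_(k < n) c k * f k x) =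
  \sum_(k < n) c k * \int[mu]_(x in D) f k x.
Proof.
move=> mD fi; elim: n => [|n [IH1 IH2]].
  split.
    apply: (eq_integrable _ (cst 0%E)) => //; last exact: integrable0.
    by move=> x _; rewrite /= big_ord0.
  under eq_Rintegral do rewrite big_ord0.
  by rewrite big_ord0 Rintegral_cst // mul0r.
have cf : mu.-integrable D (EFin \o (fun x => c n * f n x)).
  exact: (integrableZl mD (c n) (fi n)).
split.
  apply: eq_integrable (integrableD mD IH1 cf) => // x _ /=.
  by rewrite big_ord_recr.
under eq_Rintegral do rewrite big_ord_recr /=.
by rewrite RintegralD // IH2 RintegralZl // big_ord_recr.
Qed.

(** Integration over cells contracts the L1 norm, which carries an approximation on the interval
    down to a finite level. *)
Lemma sum_abs_Rintegral_fibers n (G : X -> R) (eps : R) :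
  mu.-integrable [set: X] (EFin \o G) ->
  (\int[mu]_x (`|G x|)%:E < eps%:E)%E ->
  \sum_(z : bool * dig p n) `|\int[mu]_(x in fiber n z) G x| < eps.
Proof.
move=> Gi lt; have mfib z : measurable (fiber n z) by exact: measurable_fiber.
have /integrableP[mG _] := Gi.
rewrite -lte_fin; apply: le_lt_trans lt; rewrite -sumEFin.
rewrite (ge0_integral_fibers mu mfib) //; last first.
  by apply/measurable_EFinP/measurableT_comp => //; exact/measurable_EFinP.
apply: lee_sum => z _; rewrite EFin_normr_Rintegral //; last first.
  exact: integrableS Gi.
by apply: le_abse_integral => //; exact: measurable_funTS.
Qed.

(** The indicator of the points whose sign bit is [b]. *)
Definition top_sign (b : bool) (x : X) : R :=
  (1 + (-1) ^+ b * (-1) ^+ (cellp 0 x).1) / 2.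

Lemma cell_top n x : (cellp n x).1 = (cellp 0 x).1.
Proof. by elim: n => // n <-; rewrite [in RHS]cell_lift. Qed.

Lemma not_AT : ~ AT p mu Tact.
Proof.
pose F (j : nat) : X -> R := top_sign (j == 1%N).
move=> /(_ 2%N isT F) at2.
have F01 j x : 0 <= F j x <= 1.
  by rewrite /F /top_sign; case: (j == _); case: (_.1); rewrite ?expr0 ?expr1; lra.
have mF j : measurable_fun [set: X] (F j).
  exact: (measurable_cell (fun z : bool * dig p 0 =>
    (1 + (-1) ^+ (j == 1%N) * (-1) ^+ z.1) / 2 : R)).
have Fi j : mu.-integrable [set: X] (EFin \o F j).
  apply: measurable_bounded_integrable => //; first by rewrite [X in (X < _)%E]probability_setT ltry.
  exists 1; split => // M M1 x _; have /andP[? ?] := F01 j x.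
  by rewrite /= ger0_norm // (le_trans _ (ltW M1)).
have [eps eps0 epsE] : exists2 eps : R, 0 < eps & 1000 * 1000 * eps <= 1.
  by exists (1000^-1 / 1000); lra.
have [j j2|s [g [lam [f [s0 [hg [lam0 [[f0 fi] appr]]]]]]]] := at2 _ eps eps0.
  by split; [move=> x; case/andP: (F01 j x)|exact: Fi].
have [n hn] := common_depth hg.
pose a k : dig p n := digits_of p n (g k).
have Ta k : (k < s)%N -> Tact (g k) = rotate (a k).
  by move=> ks; apply: TactE => i; exact: hn.
pose M : R := (ncell p n)%:R; have M0 : 0 < M by exact: ncellR_gt0.
(* The mean of [f] over a cell, each cell having measure [1 / M]. *)
pose fb z : R := M * \int[mu]_(x in fiber n z) f x.
(* Coefficients of group elements with the same digits are collected into one nonnegative weight on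
   the finite group. *)
pose P j h : R := \sum_(k < s | a k == h) lam j k.
(* This twist conjugates [cocycle_act] to [shift], and turns the sign bit into [esign]. *)
pose tw (z : bool * dig p n) : bool * dig p n := (z.1 (+) sgn_neg R z.2, z.2).
have twK : involutive tw by case=> b x; rewrite /tw /= addbK.
pose f' z := fb (tw z).
have fb0 z : 0 <= fb z by rewrite mulr_ge0 ?Rintegral_ge0 // ltW.
have P0 j h : (j < 2)%N -> 0 <= P j h.
  by move=> j2; apply: sumr_ge0 => k _; exact/ltW/lam0.
have tw_shift z h : tw (shift z h) = cocycle_act R h (tw z).
  by case: z => b x; rewrite /tw /shift /cocycle_act /= addbK.
have PE j z : \sum_h P j h * f' (shift z h) = \sum_(k < s) lam j k * fb (cocycle_act R (a k) (tw z)).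
  rewrite [RHS](partition_big (fun k : 'I_s => a k) xpredT) //=.
  apply: eq_bigr => h _; rewrite mulr_suml; apply: eq_bigr => k /eqP <-.
  by rewrite /f' tw_shift.
have FE j : (j < 2)%N ->
   \sum_z `|(1 + (-1) ^+ (j == 1%N) * esign (sgn_fun R (p:=p) (n:=n)) z) / 2
     - \sum_h P j h * f' (shift z h)| <= eps * #|{: bool * dig p n}|%:R.
  move=> j2; rewrite card_level // -/M.
  pose Gk k : X -> R := f \o rotate (a k).
  have Gki k : mu.-integrable [set: X] (EFin \o Gk k) by exact: integrable_rot.
  pose G : X -> R := fun x => F j x - \sum_(k < s) lam j k * Gk k x.
  have [SGi _] := @Rintegral_sum s _ (lam j) _ measurableT Gki.
  have Gi : mu.-integrable [set: X] (EFin \o G).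
    exact: (integrableB measurableT (Fi j) SGi).
  have lt : (\int[mu]_x (`|G x|)%:E < eps%:E)%E.
    apply: le_lt_trans (appr j j2); rewrite le_eqVlt; apply/orP; left; apply/eqP.
    apply: eq_integral => x _; congr (`| _ - _ |)%:E; apply: eq_bigr => k _.
    by rewrite Ta.
  have := sum_abs_Rintegral_fibers n Gi lt.
  rewrite -(ltr_pM2l M0) [M * eps]mulrC => /ltW; apply: le_trans.
  rewrite (reindex_inj (inv_inj twK)) /= mulr_sumr; apply: ler_sum => w _.
  rewrite PE twK -[X in _ <= X * _](ger0_norm (ltW M0)) -normrM.
  have mw : measurable (fiber n w) by exact: measurable_fiber.
  have Gkw k : mu.-integrable (fiber n w) (EFin \o Gk k) by exact: integrableS (Gki k).
  have [SGw SGE] := @Rintegral_sum s _ (lam j) _ mw Gkw.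
  rewrite /G RintegralB //; last exact: integrableS (Fi j).
  rewrite SGE mulrBr mulr_sumr le_eqVlt; apply/orP; left; apply/eqP.
  congr `| _ - _ |; last first.
    by apply: eq_bigr => k _; rewrite Rintegral_rot // /fb mulrCA.
  transitivity (M * \int[mu]_(x in fiber n w) ((1 + (-1) ^+ (j == 1%N) * (-1) ^+ w.1) / 2)).
    rewrite Rintegral_cst // [X in fine X](mu_fiber R p_prime w) -[fine _]/(M^-1).
    rewrite [RHS]mulrC divfK ?(gt_eqF M0) //.
    suff -> : esign (sgn_fun R (p:=p) (n:=n)) (tw w) = (-1) ^+ w.1 by [].
    by rewrite /esign /= sgn_funE -signr_addb addbK.
  congr (M * _). apply: eq_Rintegral => x; rewrite inE /= => <-.
  by rewrite /F /top_sign cell_top.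
apply: (@tiling_obstruction R (dig p n) (sgn_fun R (p:=p) (n:=n)) _ (16 / 9) _ _
  (P 0%N) (P 1%N) f' eps) => //.
- by move=> x; exact: sgn_fun2.
- exact: conv_bounded_sgn_fun.
- by move=> h; exact: P0.
- by move=> h; exact: P0.
- by move=> z; exact: fb0.
- by have := FE 0%N isT; under eq_bigr do rewrite expr0 mul1r.
- by have := FE 1%N isT; under eq_bigr do rewrite expr1 mulN1r.
Qed.

End Action.

(** * A cyclic vector, up to uniform approximation *)

Section Spectrum.
Variables (R : realType) (p : nat -> nat).
Hypothesis p_prime : forall n, prime (p n).
Hypothesis p_bound : forall n, (5 ^ (2 * n.+1) <= p n)%N.

Notation X := (measurableTypeR R).
Notation cellp := (@cell R p).
Notation sgnp := (@sgn_fun R p _).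

(** Small enough for the product of the factors [1 + bump_size n] to stay below [2]. *)
Definition bump_size n : R := 2^-1 ^+ n.+2.

Lemma bump_gt0 n : 0 < bump_size n. Proof. by rewrite exprn_gt0 // invr_gt0. Qed.

Definition weight1 n (d : 'F_(p n)) : R := 1 + bump_size n * (d == 0)%:R.

Fixpoint weight n : dig p n -> R :=
  if n is m.+1 then tensor (@weight m) (@weight1 m) else fun=> 1.

Lemma sum_weight1 n (y : 'F_(p n)) : \sum_d weight1 (y + d) = (p n)%:R + bump_size n.
Proof.
transitivity (\sum_d weight1 (d : 'F_(p n))).
  by rewrite [RHS](reindex_inj (@addrI _ y)).
rewrite /weight1 big_split /= sumr_const card_digit // -mulr_sumr.
rewrite (bigD1 0) //= ?eqxx big1 ?addr0 ?mulr1 //=.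
by move=> d /negPf->.
Qed.

Lemma spanning_weight1 n : spanning (@weight1 n).
Proof.
have c0 := bump_gt0 n; set c := bump_size n in c0.
have p0 : 0 < (p n)%:R :> R by rewrite ltr0n prime_gt0.
have D0 : (p n)%:R + c != 0 by rewrite gt_eqF // addr_gt0.
(* The first term gives [weight1 / c], which is [delta + 1 / c]; the constant term removes [1 / c],
   since all translates of [weight1] have sum [p n + c]. *)
exists (fun h => c^-1 * (h == 0)%:R - (c * ((p n)%:R + c))^-1) => x.
under eq_bigr do rewrite mulrBl.
rewrite sumrB -mulr_sumr sum_weight1 -/c.
transitivity (c^-1 * weight1 x - (c * ((p n)%:R + c))^-1 * ((p n)%:R + c)).
  congr (_ - _); under eq_bigr do rewrite -mulrA [_%:R * _]mulrC.
  by rewrite -mulr_sumr (sum_delta (fun h => weight1 (x + h))) addr0.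
rewrite /weight1 -/c; field.
by rewrite D0 gt_eqF.
Qed.

Lemma spanning_weight n : spanning (@weight n).
Proof.
elim: n => [|n IH]; last by apply: spanning_tensor; last exact: spanning_weight1.
by exists (fun=> 1) => x; rewrite big_ord1 mulr1 [x]ord1.
Qed.

Lemma spanning_sgn_fun n : spanning (sgn_fun R (p := p) (n := n)).
Proof.
elim: n => [|n IH].
  by exists (fun=> 1) => x; rewrite big_ord1 mulr1 [x]ord1.
by apply: spanning_tensor => //; apply: spanning_qsign; exact: odd_digit.
Qed.

(* Averaging over the coordinates beyond [n] reproduces a function of the first
   [n] coordinates from [weight], while it nearly annihilates [sgnp]. *)
Definition reproduces n (psi : dig p n -> R) (K e : R) :=
  exists q : dig p n -> R, [/\ \sum_g `|q g| <= K,
    forall h, \sum_g q g * weight (h + g) = psi h &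
    forall h, `|\sum_g q g * sgnp (h + g)| <= e].

Lemma reproduces_init n (psi : dig p n -> R) : exists K, reproduces psi K K.
Proof.
have [q qP] := spanning_all psi (spanning_weight n).
exists (\sum_g `|q g|), q; split => // h.
apply: le_trans (ler_norm_sum _ _ _) _; apply: ler_sum => g _.
by rewrite normrM sgn_funE normrX normrN1 expr1n mulr1.
Qed.

(** Spread [q] uniformly over the new coordinate, divided by the sum [D] of [weight1]. The even part
    is reproduced exactly. The values of [qsign] sum to [1], so the odd part is divided by
    [D >= 25], of which a factor [2] is kept. *)
Lemma reproduces_lift n (psi : dig p n -> R) K e : 0 <= e ->
  reproduces psi K e ->
  reproduces ((fun h => psi h.1) : dig p n.+1 -> R) K (e / 2).
Proof.
move=> e0 [q [qK qpsi qe]]; have c0 := bump_gt0 n.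
pose D : R := (p n)%:R + bump_size n.
have pR : 25 <= (p n)%:R :> R by rewrite ler_nat; exact: p_ge25.
have D25 : 25 <= D by rewrite /D; lra.
have D0 : 0 < D by lra.
exists (fun g => q g.1 / D); split.
- have -> : \sum_(g : dig p n.+1) `|q g.1 / D| = \sum_g \sum_(d : 'F_(p n)) `|q g / D|.
    by rewrite pair_bigA; apply: eq_bigr => -[].
  apply: le_trans qK; apply: ler_sum => g _.
  rewrite sumr_const card_digit // -mulr_natr normrM normfV (gtr0_norm D0).
  rewrite -mulrA ler_piMr // mulrC ler_pdivrMr // mul1r /D; lra.
- move=> [h y]; rewrite -[RHS]qpsi.
  transitivity (\sum_g \sum_d (q g * weight (h + g)) * (weight1 (y + d) / D)).
    by rewrite pair_bigA; apply: eq_bigr => -[g d] _ /=; rewrite /tensor /=; ring.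
  apply: eq_bigr => g _; rewrite -mulr_sumr -mulr_suml sum_weight1.
  by rewrite -/D divff ?mulr1 // gt_eqF.
- move=> [h y].
  have -> : \sum_(g : dig p n.+1) q g.1 / D * sgnp (((h, y) : dig p n.+1) + g) =
     (\sum_g q g * sgnp (h + g)) / D.
    transitivity (\sum_g \sum_d (q g * sgnp (h + g) / D) * qsign R (y + d)).
      by rewrite pair_bigA; apply: eq_bigr => -[g d] _ /=; rewrite /tensor /=; ring.
    rewrite mulr_suml; apply: eq_bigr => g _; rewrite -mulr_sumr.
    have -> : \sum_d qsign R (y + d) = 1.
      rewrite -(sum_qsign R (odd_digit p_prime p_bound n)).
      by rewrite [RHS](reindex_inj (@addrI _ y)).
    by rewrite mulr1.
  rewrite normrM normfV (gtr0_norm D0); apply: ler_pM => //; first by rewrite invr_ge0 ltW.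
  by rewrite lef_pV2 ?posrE //; lra.
Qed.

Lemma weight_ge1 n (h : dig p n) : 1 <= weight h.
Proof.
elim: n h => [|n IH] h //=; rewrite /tensor -[1]mulr1; apply: ler_pM => //.
by rewrite /weight1 lerDl mulr_ge0 // ltW // bump_gt0.
Qed.

Definition wcell n (x : X) : R := weight (cellp n x).2.

(** The bound [2 - 2^-n] sustains itself: the increment is at most [wcell n x * 2^-(n+2)], hence at
    most [2^-(n+1)]. *)
Lemma wcell_step n x : wcell n x <= 2 - 2^-1 ^+ n /\
  wcell n x <= wcell n.+1 x <= wcell n x + 2^-1 ^+ n.+1.
Proof.
have step m : wcell m x <= 2 - 2^-1 ^+ m ->
    wcell m x <= wcell m.+1 x <= wcell m x + 2^-1 ^+ m.+1.
  rewrite /wcell (cell_lift p_prime m x); case: (cell p m.+1 x) => b [h d] /= lt.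
  have z0 : 0 < (2^-1 : R) ^+ m by rewrite exprn_gt0 // invr_gt0.
  have w1 := weight_ge1 h.
  rewrite /tensor /= /weight1 /bump_size !exprSr; set z := _ ^+ m in z0 lt *.
  set w := weight h in w1 lt *.
  have zw : 0 <= z * (2 - z - w) by rewrite mulr_ge0 ?(ltW z0) // subr_ge0; lra.
  have zw0 : 0 <= z * w by rewrite mulr_ge0 ?(ltW z0) //; lra.
  have z2 : 0 <= z * z by rewrite mulr_ge0 ?(ltW z0).
  case: (d == 0); rewrite ?mulr1 ?mulr0 ?addr0; first by lra.
  by rewrite mulr1 lexx /=; lra.
have le2 : wcell n x <= 2 - 2^-1 ^+ n.
  elim: n => [|n IH]; first by rewrite /wcell /= expr0; lra.
  by have /andP[_] := step _ IH; rewrite exprSr; lra.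
by split => //; exact: step.
Qed.

(** The infinite product of the factors [weight1], a uniform limit by [feven_approx]. *)
Definition feven (x : X) : R := limn (fun n => wcell n x).

Lemma wcell_mono n k x :
  wcell n x <= wcell (n + k) x <= wcell n x + 2^-1 ^+ n - 2^-1 ^+ (n + k).
Proof.
elim: k => [|k IH]; first by rewrite addn0; lra.
by have [_] := wcell_step (n + k) x; rewrite addnS exprSr; lra.
Qed.

Lemma cvg_wcell x : (fun n => wcell n x) @ \oo --> feven x.
Proof.
apply: nondecreasing_is_cvgn.
  by move=> m n /subnKC <-; have /andP[] := wcell_mono m (n - m) x.
exists 2 => _ [n _ <-]; have [le _] := wcell_step n x; apply: le_trans le _.
by rewrite gerBl exprn_ge0 // invr_ge0.
Qed.

Lemma feven_approx n x : wcell n x <= feven x <= wcell n x + 2^-1 ^+ n.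
Proof.
have c := @cvg_wcell x.
have near_n : \forall m \near \oo, wcell n x <= wcell m x <= wcell n x + 2^-1 ^+ n.
  exists n => // m /= /subnKC <-; have /andP[-> le] := wcell_mono n (m - n) x.
  by rewrite (le_trans le) // gerBl exprn_ge0 // invr_ge0.
apply/andP; split.
  apply: (limr_ge (cvgP _ c)); near=> m.
  by have /andP[] : wcell n x <= wcell m x <= wcell n x + 2^-1 ^+ n by near: m.
apply: (limr_le (cvgP _ c)); near=> m.
by have /andP[] : wcell n x <= wcell m x <= wcell n x + 2^-1 ^+ n by near: m.
Unshelve. all: by end_near.
Qed.

Lemma measurable_feven : measurable_fun [set: X] feven.
Proof.
apply: (measurable_fun_cvg (h := wcell)) => // [n|x _]; last exact: cvg_wcell.
exact: (measurable_cell (fun z : bool * dig p n => weight z.2)).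
Qed.

Definition esgn (x : X) : R := (-1) ^+ (cellp 0 x).1.

Lemma esgnE n x : esgn x = (-1) ^+ (cellp n x).1.
Proof. by rewrite /esgn -(cell_top p_prime n). Qed.

Definition cyclic_vector (x : X) : R := feven x + esgn x.

(** An inductive form of the linear span of the orbit, convenient for closure properties; [span_sum]
    converts it into indexed sums. *)
Inductive orbit_span : (X -> R) -> Prop :=
| span_nil : orbit_span (fun=> 0)
| span_cons g c a : Gel p g -> orbit_span a ->
    orbit_span (fun x => c * cyclic_vector (Tact p g x) + a x).

Lemma span_add a b : orbit_span a -> orbit_span b -> orbit_span (fun x => a x + b x).
Proof.
move=> sa sb; elim: sa => [|g c a' hg _ IH].
  by rewrite (_ : (fun x => 0 + b x) = b) //; apply/funext => x; rewrite add0r.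
rewrite (_ : (fun x => _) = (fun x => c * cyclic_vector (Tact p g x) + (a' x + b x))).
  exact: span_cons.
by apply/funext => x; rewrite addrA.
Qed.

Lemma span_scale k a : orbit_span a -> orbit_span (fun x => k * a x).
Proof.
elim=> [|g c a' hg _ IH].
  rewrite (_ : (fun x => k * 0) = (fun=> 0)); first exact: span_nil.
  by apply/funext => x; rewrite mulr0.
rewrite (_ : (fun x => _) = (fun x => (k * c) * cyclic_vector (Tact p g x) + k * a' x)).
  exact: span_cons.
by apply/funext => x; rewrite mulrDr mulrA.
Qed.

Lemma Gel_add g h : Gel p g -> Gel p h -> Gel p (Gadd p g h).
Proof.
move=> [g1 [n gn]] [h1 [m hm]]; split.
  by move=> k; rewrite ltn_pmod // prime_gt0.
exists (maxn n m) => k; rewrite geq_max => /andP[nk mk].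
by rewrite /Gadd gn // hm // mod0n.
Qed.

Lemma span_translate h a : Gel p h -> orbit_span a -> orbit_span (fun x => a (Tact p h x)).
Proof.
move=> hh; elim=> [|g c a' hg _ IH]; first exact: span_nil.
rewrite (_ : (fun x => _) =
  (fun x => c * cyclic_vector (Tact p (Gadd p g h) x) + a' (Tact p h x))).
  by apply: span_cons => //; exact: Gel_add.
have [_ [_ comp]] := mp_action_Tact R p_prime.
by apply/funext => x; rewrite comp.
Qed.

Lemma Tact_surj n (a : dig p n) :
  exists2 g, Gel p g & @Tact R p g = rotate a.
Proof.
have [g [g1 g2 g3]] := res_surj p_prime a.
by exists g; [split => //; exists n|rewrite (TactE R p_prime g2) g3].
Qed.

(** The uniform closure of the span: the sup norm is invariant under the action and dominates the L2
    norm of the probability measure. *)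
Definition uspan (a : X -> R) := forall eps : R, 0 < eps ->
  exists2 b, orbit_span b & forall x, `|a x - b x| <= eps.

Lemma uspan_span a : orbit_span a -> uspan a.
Proof. by move=> sa eps /ltW eps0; exists a => // x; rewrite subrr normr0. Qed.

Lemma uspan_limit a :
  (forall eps : R, 0 < eps -> exists2 b, uspan b & forall x, `|a x - b x| <= eps) ->
  uspan a.
Proof.
move=> H eps eps0; have e2 : 0 < eps / 2 by rewrite divr_gt0.
have [b ub ab] := H _ e2; have [c sc bc] := ub _ e2.
exists c => // x; have -> : a x - c x = (a x - b x) + (b x - c x) by ring.
by apply: le_trans (ler_normD _ _) _; have := ab x; have := bc x; lra.
Qed.

Lemma uspan_add a b : uspan a -> uspan b -> uspan (fun x => a x + b x).
Proof.
move=> ua ub eps eps0; have e2 : 0 < eps / 2 by rewrite divr_gt0.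
have [c sc ac] := ua _ e2; have [d sd bd] := ub _ e2.
exists (fun x => c x + d x); first exact: span_add.
move=> x; have -> : a x + b x - (c x + d x) = (a x - c x) + (b x - d x) by ring.
by apply: le_trans (ler_normD _ _) _; have := ac x; have := bd x; lra.
Qed.

Lemma uspan_scale k a : uspan a -> uspan (fun x => k * a x).
Proof.
move=> ua eps eps0; have k0 : 0 < `|k| + 1 by rewrite ltr_wpDl.
have [|c sc ac] := ua (eps / (`|k| + 1)); first by rewrite divr_gt0.
exists (fun x => k * c x); first exact: span_scale.
move=> x; rewrite -mulrBr normrM.
apply: (@le_trans _ _ ((`|k| + 1) * (eps / (`|k| + 1)))).
  by apply: ler_pM => //; rewrite lerDl.
by rewrite mulrC divfK // gt_eqF.
Qed.

Lemma uspan_sum_rot n (q : dig p n -> R) a : uspan a ->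
  uspan (fun x => \sum_g q g * a (rotate g x)).
Proof.
move=> ua; elim: (index_enum _) => [|g r IH].
  rewrite (_ : (fun x => _) = (fun=> 0)); first exact/uspan_span/span_nil.
  by apply/funext => x; rewrite big_nil.
rewrite (_ : (fun x => _) = (fun x => q g * a (rotate g x) + \sum_(g <- r) q g * a (rotate g x))).
  apply: uspan_add => //; apply: uspan_scale => eps eps0.
  have [c sc ac] := ua _ eps0; have [h hh hE] := Tact_surj g.
  exists (fun x => c (rotate g x)) => //; rewrite -hE.
  exact: span_translate.
by apply/funext => x; rewrite big_cons.
Qed.

Lemma uspan_cyclic : uspan cyclic_vector.
Proof.
apply: uspan_span.
rewrite (_ : cyclic_vector = (fun x => 1 * cyclic_vector (Tact p Gzero x) + 0)).
  apply: span_cons; last exact: span_nil.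
  by split; [move=> n; exact: prime_gt0|exists 0%N].
have [_ [-> _]] := mp_action_Tact R p_prime.
by apply/funext => x; rewrite mul1r addr0.
Qed.

(** Only the factor [sgnp] depends on [g], so combinations of translates of [esgn] become
    correlations with [sgnp]. *)
Lemma esgn_rot n (g : dig p n) x : esgn (rotate g x) =
  (-1) ^+ (cellp n x).1 * (-1) ^+ sgn_neg R (cellp n x).2 * sgnp ((cellp n x).2 + g).
Proof. by rewrite (esgnE n) cell_rot // /cocycle_act /= sgn_funE !signr_addb. Qed.

Lemma wcell_rot n (g : dig p n) x : wcell n (rotate g x) = weight ((cellp n x).2 + g).
Proof. by rewrite /wcell cell_rot. Qed.

(** The same coefficients are applied to the cyclic vector: replacing [feven] by [wcell n] costs
    [K * 2^-n], and the odd part costs [e]. *)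
Lemma reproduces_uspan n (psi : dig p n -> R) K e : reproduces psi K e ->
  exists2 b, uspan b & forall x, `|psi (cellp n x).2 - b x| <= K * 2^-1 ^+ n + e.
Proof.
move=> [q [qK qpsi qe]].
exists (fun x => \sum_g q g * cyclic_vector (rotate g x)).
  by apply: uspan_sum_rot; exact: uspan_cyclic.
move=> y; rewrite -qpsi.
under [X in _ - X]eq_bigr do rewrite mulrDr esgn_rot.
rewrite big_split /= opprD addrA -sumrB; apply: le_trans (ler_normB _ _) _.
apply: lerD.
  apply: le_trans (ler_norm_sum _ _ _) _.
  apply: (@le_trans _ _ (\sum_g `|q g| * 2^-1 ^+ n)).
    apply: ler_sum => g _; rewrite -mulrBr normrM ler_wpM2l // distrC -wcell_rot.
    have /andP[l1 l2] := feven_approx n (rotate g y).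
    by rewrite ger0_norm ?subr_ge0 // lerBlDl.
  by rewrite -mulr_suml ler_wpM2r // exprn_ge0 // invr_ge0.
under eq_bigr do rewrite mulrCA.
by rewrite -mulr_sumr !normrM !normrX !normrN1 !expr1n !mul1r.
Qed.

Lemma half_pow_small (K eps : R) : 0 < eps -> exists k, K * 2^-1 ^+ k <= eps.
Proof.
move=> eps0; have [k kK] : exists k : nat, K / eps <= k%:R.
  exists (Num.truncn (K / eps)).+1; apply/ltW; exact: truncnS_gt.
exists k; rewrite exprVn ler_pdivrMr ?exprn_gt0 //.
rewrite ler_pdivrMr // in kK; apply: le_trans kK _; rewrite mulrC ler_pM2l //.
by rewrite -natrX ler_nat ltnW // ltn_expl.
Qed.

Lemma uspan_even n (psi : dig p n -> R) : uspan (fun x => psi (cellp n x).2).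
Proof.
apply: uspan_limit => eps eps0; have [K0 rK0] := reproduces_init psi.
have K0ge : 0 <= K0 by case: rK0 => q [qK _ _]; apply: le_trans qK; exact: sumr_ge0.
(* Lifting the level keeps the l1 bound [K0] and halves the odd error each time, so both error terms
   tend to [0]. *)
have H k : exists2 psi' : dig p (n + k) -> R, reproduces psi' K0 (K0 * 2^-1 ^+ k) &
    forall x, psi' (cellp (n + k) x).2 = psi (cellp n x).2.
  elim: k => [|k [psi' rp pE]].
    by rewrite addn0; exists psi => //; rewrite expr0 mulr1.
  rewrite addnS; exists (fun h => psi' h.1).
    rewrite exprSr mulrA; apply: reproduces_lift => //.
    by rewrite mulr_ge0 // exprn_ge0 // invr_ge0.
  by move=> x; rewrite -pE (cell_lift p_prime (n + k) x).
have [k kK] := half_pow_small (K0 + K0) eps0.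
have [psi' rp pE] := H k; have [b ub bE] := reproduces_uspan rp.
exists b => // x; rewrite -pE; apply: le_trans (bE x) _; apply: le_trans kK.
rewrite mulrDl lerD2r ler_wpM2l // exprD ler_piMl //.
by rewrite exprn_ile1 ?invr_ge0 // invf_le1 // ler1n.
Qed.

(** Even functions of finitely many digits approximate [feven]; subtracting it from the cyclic
    vector isolates the odd part. *)
Lemma uspan_esgn : uspan esgn.
Proof.
have ue : uspan feven.
  apply: uspan_limit => eps eps0; have [k kE] := half_pow_small 1 eps0.
  exists (wcell k); first exact: uspan_even.
  move=> x; have /andP[l1 l2] := feven_approx k x.
  by rewrite ger0_norm ?subr_ge0 // lerBlDl (le_trans l2) // lerD2l -[leLHS]mul1r.
rewrite (_ : esgn = (fun x => cyclic_vector x + (-1) * feven x)).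
  by apply: uspan_add; [exact: uspan_cyclic|exact: uspan_scale].
by apply/funext => x; rewrite /cyclic_vector; ring.
Qed.

Lemma uspan_cell n (F : bool * dig p n -> R) : uspan (fun x => F (cellp n x)).
Proof.
pose ev h := (F (false, h) + F (true, h)) / 2.
pose od h := (F (false, h) - F (true, h)) / 2.
(* The sign factor inserted here cancels the one that [esgn_rot] produces. *)
have [q qP] := spanning_all (fun h => (-1) ^+ sgn_neg R h * od h) (spanning_sgn_fun n).
rewrite (_ : (fun x => _) =
    fun x => ev (cellp n x).2 + \sum_g q g * esgn (rotate g x)).
  apply: uspan_add; first exact: uspan_even.
  by apply: uspan_sum_rot; exact: uspan_esgn.
apply/funext => x; under eq_bigr do rewrite esgn_rot mulrCA.
rewrite -mulr_sumr qP; case: (cell p n x) => b h /=.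
have s2 := sqrr_sign R (sgn_neg R h); set s := (-1) ^+ sgn_neg R h in s2 *.
rewrite -[_ * (s * _)]mulrA [s * (s * _)]mulrA -expr2 s2 mul1r.
by rewrite /ev /od; case: b; rewrite ?expr0 ?expr1; lra.
Qed.

End Spectrum.

(** * Density of step functions and simple spectrum *)

Section Clip.
Variable R : realType.

Definition clip (K s : R) : R := Num.max (- K) (Num.min s K).

Lemma clip_le K s : 0 <= K -> `|clip K s| <= K.
Proof.
move=> K0; rewrite ler_norml /clip le_max lexx /= ge_max ge_min lexx orbT andbT; lra.
Qed.

Lemma clip_id K s : `|s| <= K -> clip K s = s.
Proof.
by rewrite ler_norml => /andP[l1 l2]; rewrite /clip min_l // max_r.
Qed.

Lemma clip_lipschitz K s t : `|clip K s - clip K t| <= `|s - t|.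
Proof.
have H : forall a b, a <= b -> clip K a <= clip K b /\ clip K b - clip K a <= b - a.
  move=> a b ab; rewrite /clip.
  by case: (leP a K) => ?; case: (leP b K) => ?; rewrite ?maxEle;
     repeat case: ifPn; rewrite -?ltNge; lra.
have [st|/ltW st] := leP s t; have [h1 h2] := H _ _ st.
  by rewrite distrC [leRHS]distrC !ger0_norm ?subr_ge0.
by rewrite !ger0_norm ?subr_ge0.
Qed.

Lemma measurable_clip d (T : measurableType d) K (f : T -> R) :
  measurable_fun [set: T] f -> measurable_fun [set: T] (fun x => clip K (f x)).
Proof.
by move=> mf; apply: measurable_maxr => //; apply: measurable_minr.
Qed.

(** Dominated convergence, reduced to one index with a small integral. *)
Lemma dominated_small d (T : measurableType d) (mu : {measure set T -> \bar R})
    (f : nat -> T -> R) (g : T -> R) :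
  (forall n, measurable_fun [set: T] (f n)) ->
  (forall n x, 0 <= f n x <= g x) -> mu.-integrable [set: T] (EFin \o g) ->
  {ae mu, forall x, (fun n => f n x) @ \oo --> (0 : R)} ->
  forall eps : R, 0 < eps -> exists n, (\int[mu]_x (f n x)%:E < eps%:E)%E.
Proof.
move=> mf fg gi f0 eps eps0.
have mE n : measurable_fun [set: T] (fun x => (f n x)%:E) by exact/measurable_EFinP.
have c0 : {ae mu, forall x, [set: T] x -> (fun n => (f n x)%:E) @ \oo --> (cst 0%E : T -> \bar R) x}.
  apply: filterS f0 => x cx _; apply: cvg_EFin; first exact: nearW.
  exact: cx.
have bd : {ae mu, forall x n, [set: T] x -> (`|(f n x)%:E| <= (EFin \o g) x)%E}.
  apply: aeW => x n _; have /andP[h0 h1] := fg n x.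
  by rewrite /= lee_fin ger0_norm.
have [_ _] := dominated_convergence measurableT mE (measurable_cst _) c0 gi bd.
rewrite integral0 => /(_ _ (@nbhs_open_ereal_lt _ _ (fun=> eps) eps0)) [n _ h].
by exists n; exact: (h n (leqnn n)).
Qed.

End Clip.

(** * Mean square approximation by functions of a cell *)

Section Density.
Variables (R : realType) (p : nat -> nat).
Hypothesis p_prime : forall n, prime (p n).
Hypothesis p_bound : forall n, (5 ^ (2 * n.+1) <= p n)%N.

Notation X := (measurableTypeR R).
Notation mu := (uniform_prob (@ltr01 R)).
Notation cellp := (@cell R p).

Definition sqdist (a b : X -> R) : \bar R := (\int[mu]_x ((a x - b x) ^+ 2)%:E)%E.

Lemma measurable_sq (a b : X -> R) : measurable_fun [set: X] a ->
  measurable_fun [set: X] b -> measurable_fun [set: X] (fun x => (a x - b x) ^+ 2).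
Proof. by move=> ma mb; apply: measurable_funX; exact: measurable_funB. Qed.

(** From [(u + v)^2 <= 2 u^2 + 2 v^2]; this is the source of the quarters of [eps] below. *)
Lemma sqdist_triangle (a b c : X -> R) (e1 e2 : R) : measurable_fun [set: X] a ->
  measurable_fun [set: X] b -> measurable_fun [set: X] c ->
  (sqdist a b < e1%:E)%E -> (sqdist b c < e2%:E)%E ->
  (sqdist a c < (2 * e1 + 2 * e2)%:E)%E.
Proof.
move=> ma mb mc ab bc.
have mE (u v : X -> R) : measurable_fun [set: X] u -> measurable_fun [set: X] v ->
    measurable_fun [set: X] (fun x => ((u x - v x) ^+ 2)%:E).
  by move=> mu_ mv; apply/measurable_EFinP; exact: measurable_sq.
have sq0 (u v : X -> R) x : (0 <= ((u x - v x) ^+ 2)%:E)%E by rewrite lee_fin sqr_ge0.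
apply: (@le_lt_trans _ _ (2%:E * sqdist a b + 2%:E * sqdist b c)%E).
  rewrite /sqdist -!ge0_integralZl //; [|exact: mE|exact: mE].
  rewrite -ge0_integralD //; first last.
  - by apply: measurable_funeM; exact: mE.
  - by move=> x _; rewrite mule_ge0.
  - by apply: measurable_funeM; exact: mE.
  - by move=> x _; rewrite mule_ge0.
  apply: ge0_le_integral => //.
  - exact: mE.
  - by apply: emeasurable_funD; apply: measurable_funeM; exact: mE.
  - move=> x _; rewrite -!EFinM -EFinD lee_fin.
    by have := sqr_ge0 (a x - b x - (b x - c x)); nra.
have -> : (2 * e1 + 2 * e2)%:E = (2%:E * e1%:E + 2%:E * e2%:E)%E by [].
by apply: lteD; rewrite lte_pmul2l // lte_fin.
Qed.

Definition step_limit (a : X -> R) := forall eps : R, 0 < eps ->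
  exists n (F : bool * dig p n -> R), (sqdist a (fun x => F (cellp n x)) < eps%:E)%E.

Lemma step_limit_trans (a : X -> R) : measurable_fun [set: X] a ->
  (forall eps : R, 0 < eps -> exists b, [/\ measurable_fun [set: X] b,
     (sqdist a b < eps%:E)%E & step_limit b]) -> step_limit a.
Proof.
move=> ma H eps eps0; have e4 : 0 < eps / 4 by rewrite divr_gt0.
have [b [mb ab sb]] := H _ e4; have [n [F bF]] := sb _ e4.
exists n, F; have -> : eps = 2 * (eps / 4) + 2 * (eps / 4) by lra.
apply: sqdist_triangle ab bF => //; exact: (measurable_cell F).
Qed.

Lemma ae_unitI (P : X -> Prop) : (forall x : R, 0 <= x < 1 -> P x) -> {ae mu, forall x, P x}.
Proof.
move=> HP; exists (~` `[0, 1[%classic); split.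
- exact: measurableC.
- by rewrite uniform_lebesgue ?setICl ?measure0 //; exact: measurableC.
- by move=> x; apply: contra_not => /=; rewrite in_itv; exact: HP.
Qed.

Lemma cell_near n (x : R) : 0 <= x < 1 ->
  `|x - (enc (cellp n x))%:R / (ncell p n)%:R| <= 2^-1 ^+ n.
Proof.
move=> x01; have M0 := ncellR_gt0 R p_prime n.
have [kn [t /andP[t0 t1] E]] := kcellP p_prime n x.
have f0 : Num.floor x = 0 by apply/floor_unitI; rewrite /= in_itv.
rewrite /cell decK // {1}E f0 mulr0z add0r -mulrBl addrAC subrr add0r.
rewrite ger0_norm ?divr_ge0 ?(ltW M0) // exprVn.
apply: le_trans (_ : (ncell p n)%:R^-1 <= _).
  by rewrite ler_pdivrMr // mulVf ?gt_eqF // ltW.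
rewrite lef_pV2 ?posrE ?exprn_gt0 // -natrX ler_nat ltnW //.
exact: expn_ncell.
Qed.

(** Sample at the left endpoint of the cell: these points converge to [x], and clipping supplies the
    dominating constant. *)
Lemma step_limit_clip (g : R -> R) (K : R) : 0 <= K -> continuous g ->
  step_limit (fun x => clip K (g x)).
Proof.
move=> K0 cg.
have mg : measurable_fun [set: X] (g : X -> R) by exact: continuous_measurable_fun.
pose F n (z : bool * dig p n) := clip K (g ((enc z)%:R / (ncell p n)%:R)).
move=> eps eps0.
suff [n lt] : exists n, (\int[mu]_x ((clip K (g x) - F n (cellp n x)) ^+ 2)%:E < eps%:E)%E.
  by exists n, (F n).
apply: (@dominated_small _ _ _ mu (fun n x => (clip K (g x) - F n (cellp n x)) ^+ 2)
  (cst ((2 * K) ^+ 2))) => //.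
- move=> n; apply: measurable_sq; first exact: measurable_clip.
  exact: (measurable_cell (F n)).
- move=> n x; rewrite sqr_ge0 /= -ler_sqrt ?sqr_ge0 // !sqrtr_sqr.
  rewrite (ger0_norm (_ : 0 <= 2 * K)) ?mulr_ge0 //.
  apply: le_trans (ler_normB _ _) _.
  by have := clip_le (g x) K0; have := clip_le (g ((enc (cellp n x))%:R / (ncell p n)%:R)) K0;
    rewrite /F; lra.
- exact: finite_measure_integrable_cst.
apply: ae_unitI => x x01.
have cx : (fun n => (enc (cellp n x))%:R / (ncell p n)%:R : R) @ \oo --> x.
  apply/cvgrPdist_le => e e0; have [k kE] := half_pow_small 1 e0.
  exists k => // n /= kn; apply: le_trans (cell_near n x01) _; apply: le_trans kE.
  by rewrite mul1r ler_wiXn2l // ?invr_ge0 // invf_le1 // ler1n.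
have cF : (fun n => F n (cellp n x)) @ \oo --> clip K (g x).
  have cgx : (fun n => g ((enc (cellp n x))%:R / (ncell p n)%:R)) @ \oo --> g x.
    by apply: (cvg_comp _ _ cx); exact: cg.
  apply/cvgrPdist_le => e e0; move/cvgrPdist_le : cgx => /(_ _ e0).
  by apply: filterS => n; apply: le_trans; exact: clip_lipschitz.
have cD : (fun n => clip K (g x) - F n (cellp n x)) @ \oo --> (0 : R).
  by rewrite -(subrr (clip K (g x))); apply: cvgB => //; exact: cvg_cst.
by have := cvgM cD cD; rewrite mulr0; exact.
Qed.

(** Continuous functions approximate [a] in L1. Clipping them at [K] brings them no farther from
    [a], and boundedness turns L1 closeness into L2 closeness. *)
Lemma step_limit_bounded (a : X -> R) (K : R) : measurable_fun [set: X] a ->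
  0 <= K -> (forall x, `|a x| <= K) -> step_limit a.
Proof.
move=> ma K0 aK; apply: step_limit_trans => // eps eps0.
have E01 : measurable (`[0, 1]%classic : set X) by [].
have fin01 : (lebesgue_measure (`[0%R, 1%R]%classic : set X) < +oo :> \bar R)%E.
  by rewrite lebesgue_measure_itv /= lte_fin ltr01 -EFinB ltry.
have ia : lebesgue_measure.-integrable (`[0, 1]%classic : set X) (EFin \o a).
  apply: measurable_bounded_integrable => //; first exact: measurable_funTS.
  by exists K; split; [exact: num_real|move=> M KM x _]; rewrite /= (le_trans (aK x)) // ltW.
have [g_ [cg _ lim0]] := approximation_continuous_integrable E01 fin01 ia.
(* The difference of two functions bounded by [K] is at most [2 * K]; adding [1] keeps the divisor
   positive when [K = 0]. *)
have k0 : 0 < 2 * K + 1 by lra.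
have e0 : 0 < eps / (2 * K + 1) by rewrite divr_gt0.
have [n _ /(_ n (leqnn n)) /= lt] := lim0 _ (@nbhs_open_ereal_lt _ _ (fun=> eps / (2 * K + 1)) e0).
have mg : measurable_fun [set: X] (g_ n : X -> R).
  exact: (continuous_measurable_fun (cg n)).
exists (fun x => clip K (g_ n x)); split; first exact: measurable_clip.
  have mag : measurable_fun [set: X] (fun x => (`|a x - g_ n x|)%:E).
    apply/measurable_EFinP; apply: measurableT_comp => //; exact: measurable_funB.
  apply: (@le_lt_trans _ _ ((2 * K + 1)%:E * \int[mu]_x (`|a x - g_ n x|)%:E)%E).
    rewrite -ge0_integralZl //; last by rewrite lee_fin ltW.
    apply: ge0_le_integral => //.
    - by move=> x _; rewrite lee_fin sqr_ge0.
    - by apply/measurable_EFinP; apply: measurable_sq => //; exact: measurable_clip.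
    - exact: measurable_funeM.
    move=> x _; rewrite -EFinM lee_fin -real_normK ?num_real // expr2.
    apply: ler_pM => //.
      apply: le_trans (ler_normB _ _) _.
      by have := clip_le (g_ n x) K0; have := aK x; lra.
    by rewrite -{1}(clip_id (aK x)); exact: clip_lipschitz.
  rewrite integral_uniform //.
  rewrite subr0 invr1 mul1e.
  have -> : eps = (2 * K + 1) * (eps / (2 * K + 1)) by rewrite mulrC divfK // gt_eqF.
  by rewrite EFinM lte_pmul2l // lte_fin.
exact: step_limit_clip.
Qed.

(** Truncate at height [n]; the squared error is dominated by [a ^+ 2] and vanishes at each point
    for large [n]. *)
Lemma step_limit_L2 (a : X -> R) : L2fun mu a -> step_limit a.
Proof.
move=> [ma a2]; apply: step_limit_trans => // eps eps0.
have ia : mu.-integrable [set: X] (EFin \o (fun x => a x ^+ 2)).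
  apply/integrableP; split; first by apply/measurable_EFinP; exact: measurable_funX.
  under eq_integral do rewrite /= ger0_norm ?sqr_ge0 //.
  exact: a2.
have [| | |n lt] := @dominated_small _ _ _ mu
   (fun n x => (a x - clip n%:R (a x)) ^+ 2) (fun x => a x ^+ 2) _ _ ia _ _ eps0.
- by move=> n; apply: measurable_sq => //; exact: measurable_clip.
- move=> n x; rewrite sqr_ge0 /= -ler_sqrt ?sqr_ge0 // !sqrtr_sqr.
  have [le|lt] := leP `|a x| n%:R; first by rewrite clip_id // subrr normr0.
  have n0 := ler0n R n; have [ax|ax] := leP 0 (a x).
    rewrite (ger0_norm ax) in lt *.
    have -> : clip n%:R (a x) = n%:R.
      by rewrite /clip min_r ?(ltW lt) // max_r //; lra.
    by rewrite ger0_norm; lra.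
  rewrite (ltr0_norm ax) in lt *.
  have -> : clip n%:R (a x) = - n%:R.
    rewrite /clip min_l; last by lra.
    by rewrite max_l //; lra.
  by rewrite ltr0_norm; lra.
- apply: aeW => x; apply: cvg_near_cst.
  exists (Num.truncn `|a x|).+1 => // n /= hn.
  rewrite clip_id ?subrr ?expr0n //; apply: ltW; apply: lt_le_trans (truncnS_gt _) _.
  by rewrite ler_nat.
exists (fun x => clip n%:R (a x)); split => //; first exact: measurable_clip.
apply: (@step_limit_bounded _ n%:R) => //; first exact: measurable_clip.
by move=> x; exact: clip_le.
Qed.

Lemma measurable_Tact g : Gel p g -> measurable_fun [set: X] (Tact p g : X -> X).
Proof. by have [h _] := mp_action_Tact R p_prime; move=> /h[]. Qed.

Lemma measurable_cyclic : measurable_fun [set: X] (@cyclic_vector R p).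
Proof.
apply: measurable_funD; first exact: measurable_feven.
exact: (measurable_cell (fun z : bool * dig p 0 => (-1) ^+ z.1 : R)).
Qed.

Lemma measurable_span (b : X -> R) : orbit_span p b -> measurable_fun [set: X] b.
Proof.
elim=> [|g c a hg _ IH]; first exact: measurable_cst.
apply: measurable_funD => //; apply: measurable_funM => //.
by apply: measurableT_comp; [exact: measurable_cyclic|exact: measurable_Tact].
Qed.

Lemma span_dense (a : X -> R) (eps : R) : L2fun mu a -> 0 < eps ->
  exists2 b, orbit_span p b & (sqdist a b < eps%:E)%E.
Proof.
move=> a2 eps0; have e4 : 0 < eps / 4 by rewrite divr_gt0.
have [n [F aF]] := step_limit_L2 a2 e4.
(* As [e <= 1], a uniform error [e] has square at most [e <= eps / 8], strictly below the quarter
   that is available. *)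
pose e := Num.min 1 (eps / 8).
have e0 : 0 < e by rewrite lt_min ltr01 divr_gt0.
have [b sb Fb] := uspan_cell p_prime p_bound F e0.
exists b => //; have mb := measurable_span sb.
have mF : measurable_fun [set: X] (fun x => F (cellp n x)) by exact: (measurable_cell F).
have -> : eps = 2 * (eps / 4) + 2 * (eps / 4) by lra.
apply: (sqdist_triangle a2.1 mF mb aF).
apply: (@le_lt_trans _ _ (\int[mu]_x (cst (eps / 8)%:E) x)%E).
  apply: ge0_le_integral => //.
  - by move=> x _; rewrite lee_fin sqr_ge0.
  - by apply/measurable_EFinP; exact: measurable_sq.
  move=> x _; rewrite lee_fin -real_normK ?num_real //.
  have le1 : e <= 1 by rewrite ge_min lexx.
  have le8 : e <= eps / 8 by rewrite ge_min lexx orbT.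
  apply: le_trans le8; have h := Fb x; have h0 := normr_ge0 (F (cellp n x) - b x).
  by set u := `|_| in h h0 *; nra.
by rewrite integral_cst // [X in (_ * X)%E]probability_setT mule1 lte_fin; lra.
Qed.

Lemma span_sum (b : X -> R) : orbit_span p b ->
  exists (s : nat) (g : nat -> nat -> nat) (c : nat -> R),
    (forall k, (k < s)%N -> Gel p (g k)) /\
    forall x, b x = \sum_(k < s) c k * cyclic_vector p (Tact p (g k) x).
Proof.
elim=> [|g c a hg _ [s [h [d [hh aE]]]]].
  by exists 0%N, (fun=> Gzero), (fun=> 0); split => // x; rewrite big_ord0.
exists s.+1, (fun k => if k is k'.+1 then h k' else g),
  (fun k => if k is k'.+1 then d k' else c); split; first by case.
by move=> x; rewrite big_ord_recl aE.
Qed.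

Lemma simple_spectrum_Tact : simple_spectrum p mu (Tact p).
Proof.
have mc := measurable_cyclic.
exists (@cyclic_vector R p), (fun=> 0); split; [split => //|split; [split => //|]].
(* Here [feven] lies between [1] and [2], and [esgn] is [1] or [-1]. *)
- apply: (@le_lt_trans _ _ (\int[mu]_x (cst (3 ^+ 2)%:E) x)%E).
    apply: ge0_le_integral => //.
    + by move=> x _; rewrite lee_fin sqr_ge0.
    + by apply/measurable_EFinP; exact: measurable_funX.
    move=> x _; rewrite lee_fin; have /andP[l1 l2] := feven_approx p_prime 0 x.
    have l0 : 0 <= feven p x <= 2.
      by move: l1 l2; rewrite /wcell /= expr0; lra.
    by rewrite /cyclic_vector /esgn; case: (_.1); rewrite ?expr0 ?expr1; nra.
  by rewrite integral_cst // [X in (_ * X)%E]probability_setT mule1 ltry.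
- by under eq_integral do rewrite expr0n; rewrite integral0 ltry.
move=> a b a2 b2 eps eps0; have e2 : 0 < eps / 2 by rewrite divr_gt0.
have [a' sa aa] := span_dense a2 e2; have [b' sb bb] := span_dense b2 e2.
have ma := measurable_span sa; have mb := measurable_span sb.
have [s1 [g1 [c1 [G1 E1]]]] := span_sum sa; have [s2 [g2 [c2 [G2 E2]]]] := span_sum sb.
(* The cyclic vector is real, so real coefficients approximate [a] and imaginary ones approximate
   [b]; the two families are concatenated. *)
exists (s1 + s2)%N, (fun k => if (k < s1)%N then g1 k else g2 (k - s1)%N),
  (fun k => if (k < s1)%N then c1 k else 0),
  (fun k => if (k < s1)%N then 0 else c2 (k - s1)%N); split.
  move=> k ks; case: ltnP => ks1; first exact: G1.
  by apply: G2; rewrite ltn_subLR.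
have EA x : \sum_(k < s1 + s2) ((if (k < s1)%N then c1 k else 0) *
    cyclic_vector p (Tact p (if (k < s1)%N then g1 k else g2 (k - s1)%N) x) -
    (if (k < s1)%N then 0 else c2 (k - s1)%N) * 0) = a' x.
  rewrite big_split_ord /= E1 [X in _ + X]big1 ?addr0 => [|k _].
    by apply: eq_bigr => k _; rewrite ltn_ord mul0r subr0.
  by rewrite ltnNge leq_addr /= mul0r mulr0 subr0.
have EB x : \sum_(k < s1 + s2) ((if (k < s1)%N then c1 k else 0) * 0 +
    (if (k < s1)%N then 0 else c2 (k - s1)%N) *
    cyclic_vector p (Tact p (if (k < s1)%N then g1 k else g2 (k - s1)%N) x)) = b' x.
  rewrite big_split_ord /= E2 [X in X + _]big1 ?add0r => [|k _].
    by apply: eq_bigr => k _; rewrite ltnNge leq_addr /= mulr0 add0r addKn.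
  by rewrite ltn_ord mul0r mulr0 addr0.
under eq_integral do rewrite EA EB EFinD.
rewrite ge0_integralD //.
- by rewrite [eps]splitr EFinD; exact: lteD.
- by move=> x _; rewrite lee_fin sqr_ge0.
- by apply/measurable_EFinP; apply: measurable_sq => //; exact: a2.1.
- by move=> x _; rewrite lee_fin sqr_ge0.
- by apply/measurable_EFinP; apply: measurable_sq => //; exact: b2.1.
Qed.

End Density.

Theorem theorem1p1 (R : realType) (p : nat -> nat)
  (hprime : forall n, prime (p n))
  (hinc : forall n, (p n < p n.+1)%N)
  (hbound : forall n, (5 ^ (2 * n.+1) <= p n)%N) :
  exists (d : measure_display) (X : measurableType d) (mu : probability X R)
         (T : (nat -> nat) -> X -> X),
    standard_borel R X /\ mp_action p mu T /\ simple_spectrum p mu T /\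
    ~ AT p mu T.
Proof.
exists _, (measurableTypeR R), (uniform_prob (@ltr01 R)), (Tact p); split.
  exists id; split; first by [].
  split; first exact: measurable_id.
  split; first by rewrite image_id; exact: measurableT.
  by move=> A mA; rewrite image_id.
split; first exact: mp_action_Tact.
split; first exact: simple_spectrum_Tact.
exact: not_AT.
Qed.
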